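(* Let $G$ be a graph product of finite groups (over a finite simplicial graph). All strongly cellular, cocompact cubulations of $G$ induce the same coarse median structure on $G$.
   Context: Given a finite simplicial graph $\Gamma$ and finite groups $\{F_v\}_{v\in\Gamma}$ indexed by its vertices, the graph product is the quotient of the free product of the $F_v$ by the normal subgroup generated by the commutator sets $[F_w,F_{w'}]$ for all edges $[w,w']$ of $\Gamma$. A cocompact cubulation of a group $G$ is a proper cocompact action $G\curvearrowright X$ by cubical automorphisms on a CAT(0) cube complex $X$. The action is strongly cellular if the set of fixed points of each element of $G$ is a subcomplex of $X$ (equivalently, if an element preserves a cube, it fixes it pointwise). Let $d_X$ be the combinatorial metric on $X^{(0)}$. The median $m(x,y,z)$ of vertices $x,y,z\in X$ is the unique vertex lying on a $1$-skeleton geodesic between any two of the three vertices. Given a cocompact cubulation $G\curvearrowright X$, fix a vertex $v\in X$. A cubical coarse median induced by $G\curvearrowright X$ is a map $\mu_X\colon G^3\to G$ with $\sup_{g_1,g_2,g_3\in G}d_X\big(\mu_X(g_1,g_2,g_3)v,\,m(g_1v,g_2v,g_3v)\big)<\infty$ (the pull-back of $m$ via the equivariant quasi-isometry $g\mapsto gv$; changing $v$ changes $\mu_X$ only by a bounded amount). Two cocompact cubulations $G\curvearrowright X$, $G\curvearrowright Y$ induce the same coarse median structure on $G$ if $\sup_{g_1,g_2,g_3}d_G(\mu_X(g_1,g_2,g_3),\mu_Y(g_1,g_2,g_3))<\infty$ for a word metric $d_G$ on $G$. *)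

(* Defs.v *)
From HB Require Import structures.
From Stdlib Require Import Relation_Operators.
From mathcomp Require Import all_boot all_fingroup.
From mathcomp Require Import all_classical.

Set Implicit Arguments.
Unset Strict Implicit.
Unset Printing Implicit Defensive.

Local Open Scope classical_set_scope.
Local Open Scope quotient_scope.
Local Open Scope group_scope.

Section FreeProduct.
Variables (I : finType) (F : I -> finGroupType).

Local Notation letter := {i : I & F i}.
Local Notation word := (seq letter).

Definition lett (i : I) (a : F i) : letter := Tagged F a.

Inductive word_step : word -> word -> Prop :=
| word_step1 (u w : word) (i : I) :
    word_step (u ++ lett (1 : F i) :: w) (u ++ w)
| word_stepM (u w : word) (i : I) (a b : F i) :
    word_step (u ++ lett a :: lett b :: w) (u ++ lett (a * b) :: w).

Definition word_equiv : word -> word -> Prop := clos_refl_sym_trans _ word_step.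

Definition word_equivb : rel word := fun u w => `[< word_equiv u w >].

Lemma word_equivb_refl : reflexive word_equivb.
Proof. by move=> u; apply/asboolP; apply: rst_refl. Qed.

Lemma word_equivb_sym : symmetric word_equivb.
Proof.
by move=> u w; apply/idP/idP => /asboolP h; apply/asboolP; apply: rst_sym.
Qed.

Lemma word_equivb_trans : transitive word_equivb.
Proof.
move=> w u z /asboolP h1 /asboolP h2; apply/asboolP.
exact: rst_trans h1 h2.
Qed.

Canonical word_equiv_rel :=
  EquivRel word_equivb word_equivb_refl word_equivb_sym word_equivb_trans.

Definition free_product : Type := {eq_quot word_equiv_rel}.
HB.instance Definition _ := Choice.on free_product.

Lemma word_equiv_ctx (p q u w : word) :
  word_equiv u w -> word_equiv (p ++ u ++ q) (p ++ w ++ q).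
Proof.
elim=> {u w}.
- move=> u w [{}u {}w i|{}u {}w i a b]; apply: rst_step.
  + by rewrite -!catA !cat_cons !(catA p); apply: word_step1.
  + by rewrite -!catA !cat_cons !(catA p); apply: word_stepM.
- by move=> u; apply: rst_refl.
- by move=> u w _; apply: rst_sym.
- by move=> u w z _ h1 _ h2; apply: rst_trans h1 h2.
Qed.

Lemma word_equiv_cat (u u' w w' : word) :
  word_equiv u u' -> word_equiv w w' -> word_equiv (u ++ w) (u' ++ w').
Proof.
move=> hu hw; apply: (rst_trans _ _ _ (u' ++ w)).
- exact: (word_equiv_ctx [::] w hu).
- by have := word_equiv_ctx u' [::] hw; rewrite !cats0.
Qed.

Definition lett_inv (x : letter) : letter :=
  let: existT _ a := x in lett a^-1.

Definition word_inv (u : word) : word :=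
  rev [seq lett_inv x | x <- u].

Lemma word_inv_cat (u w : word) : word_inv (u ++ w) = word_inv w ++ word_inv u.
Proof. by rewrite /word_inv map_cat rev_cat. Qed.

Lemma word_inv_cons x (w : word) :
  word_inv (x :: w) = word_inv w ++ [:: lett_inv x].
Proof. by rewrite -cat1s word_inv_cat. Qed.

Lemma word_equiv_inv (u w : word) :
  word_equiv u w -> word_equiv (word_inv u) (word_inv w).
Proof.
elim=> {u w}.
- move=> u w [{}u {}w i|{}u {}w i a b]; apply: rst_step;
    rewrite !word_inv_cat !word_inv_cons /= -!catA.
  + by rewrite invg1; apply: word_step1.
  + by rewrite invMg; apply: word_stepM.
- by move=> u; apply: rst_refl.
- by move=> u w _; apply: rst_sym.
- by move=> u w z _ h1 _ h2; apply: rst_trans h1 h2.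
Qed.

Lemma word_equivV (u : word) : word_equiv (word_inv u ++ u) [::].
Proof.
elim: u => [|[i a] u IH]; first exact: rst_refl.
rewrite word_inv_cons -catA /=; apply: rst_trans IH.
apply: (rst_trans _ _ _ (word_inv u ++ lett (a^-1 * a) :: u)).
  by apply: rst_step; apply: word_stepM.
by rewrite mulVg; apply: rst_step; apply: word_step1.
Qed.

Lemma word_invK : involutive word_inv.
Proof.
elim=> [//|[i a] u IH].
by rewrite word_inv_cons word_inv_cat IH /word_inv /= invgK.
Qed.

Definition fp_pi (u : word) : free_product := \pi_({eq_quot word_equiv_rel}) u.
Definition fp_repr (x : free_product) : word :=
  generic_quotient.repr (x : {eq_quot word_equiv_rel}).

Lemma fp_reprK x : fp_pi (fp_repr x) = x.
Proof. exact: reprK. Qed.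

Lemma fp_piP u w : fp_pi u = fp_pi w <-> word_equiv u w.
Proof.
split=> [/eqmodP/asboolP //|h].
by apply/eqmodP/asboolP.
Qed.

Lemma fp_pi_repr u : word_equiv (fp_repr (fp_pi u)) u.
Proof. by apply/fp_piP; rewrite fp_reprK. Qed.

Definition fp_one : free_product := fp_pi [::].
Definition fp_mul (x y : free_product) : free_product :=
  fp_pi (fp_repr x ++ fp_repr y).
Definition fp_inv (x : free_product) : free_product :=
  fp_pi (word_inv (fp_repr x)).

Lemma fp_mul_pi u w : fp_mul (fp_pi u) (fp_pi w) = fp_pi (u ++ w).
Proof. by apply/fp_piP; apply: word_equiv_cat; apply: fp_pi_repr. Qed.

Lemma fp_inv_pi u : fp_inv (fp_pi u) = fp_pi (word_inv u).
Proof. by apply/fp_piP; apply: word_equiv_inv; apply: fp_pi_repr. Qed.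

Lemma fp_mulA : associative fp_mul.
Proof.
move=> x y z; rewrite -(fp_reprK x) -(fp_reprK y) -(fp_reprK z).
by rewrite !fp_mul_pi catA.
Qed.

Lemma fp_mul1 : left_id fp_one fp_mul.
Proof. by move=> x; rewrite -(fp_reprK x) fp_mul_pi. Qed.

Lemma fp_mulr1 : right_id fp_one fp_mul.
Proof. by move=> x; rewrite -(fp_reprK x) fp_mul_pi cats0. Qed.

Lemma fp_mulV : left_inverse fp_one fp_inv fp_mul.
Proof.
move=> x; rewrite -(fp_reprK x) fp_inv_pi fp_mul_pi.
by apply/fp_piP; apply: word_equivV.
Qed.

Lemma fp_mulrV : right_inverse fp_one fp_inv fp_mul.
Proof.
move=> x; rewrite -(fp_reprK x) fp_inv_pi fp_mul_pi; apply/fp_piP.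
by rewrite -{1}(word_invK (fp_repr x)); apply: word_equivV.
Qed.

HB.instance Definition _ := isGroup.Build free_product
  fp_mulA fp_mul1 fp_mulr1 fp_mulV fp_mulrV.

Definition fp_inj (i : I) (a : F i) : free_product := fp_pi [:: lett a].

End FreeProduct.

Section QuotientGroup.
Variable P : groupType.

Definition is_normal_subgroup (N : set P) : Prop :=
  [/\ N 1, forall x y, N x -> N y -> N (x * y), forall x, N x -> N x^-1
    & forall x y, N x -> N (x ^ y)].

Record normal_subgroup : Type := NormalSubgroup {
  nsg_set :> P -> Prop;
  nsgP : is_normal_subgroup nsg_set }.

Lemma normal_closure_subproof (A : set P) :
  is_normal_subgroup (smallest is_normal_subgroup A).
Proof.
split.
- by move=> M [[]].
- move=> x y hx hy M hMA; have [[_ hM _ _] _] := hMA.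
  exact: hM (hx M hMA) (hy M hMA).
- move=> x hx M hMA; have [[_ _ hV _] _] := hMA.
  exact: hV (hx M hMA).
- move=> x y hx M hMA; have [[_ _ _ hJ] _] := hMA.
  exact: hJ (hx M hMA).
Qed.

Definition normal_closure (A : set P) : normal_subgroup :=
  NormalSubgroup (normal_closure_subproof A).

Variable N : normal_subgroup.

Definition coset_eq : rel P := fun x y => `[< N (x^-1 * y) >].

Lemma coset_eq_refl : reflexive coset_eq.
Proof. by move=> x; apply/asboolP; rewrite mulVg; case: (nsgP N). Qed.

Lemma coset_eq_sym : symmetric coset_eq.
Proof.
have h x y : coset_eq x y -> coset_eq y x.
  move=> /asboolP hxy; apply/asboolP.
  by rewrite -[y^-1 * x]invgK invMg invgK; case: (nsgP N) => _ _ hV _; apply: hV.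
by move=> x y; apply/idP/idP; apply: h.
Qed.

Lemma coset_eq_trans : transitive coset_eq.
Proof.
move=> y x z /asboolP hxy /asboolP hyz; apply/asboolP.
have -> : x^-1 * z = (x^-1 * y) * (y^-1 * z) by rewrite mulgA mulgK.
by case: (nsgP N) => _ hM _ _; apply: hM.
Qed.

Canonical coset_equiv_rel :=
  EquivRel coset_eq coset_eq_refl coset_eq_sym coset_eq_trans.

Definition quotient_group : Type := {eq_quot coset_equiv_rel}.
HB.instance Definition _ := Choice.on quotient_group.

Definition qg_pi (x : P) : quotient_group := \pi_({eq_quot coset_equiv_rel}) x.
Definition qg_repr (x : quotient_group) : P :=
  generic_quotient.repr (x : {eq_quot coset_equiv_rel}).

Lemma qg_reprK x : qg_pi (qg_repr x) = x.
Proof. exact: reprK. Qed.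

Lemma qg_piP x y : qg_pi x = qg_pi y <-> N (x^-1 * y).
Proof.
split=> [/eqmodP/asboolP //|h].
by apply/eqmodP/asboolP.
Qed.

Lemma qg_pi_repr x : N ((qg_repr (qg_pi x))^-1 * x).
Proof. by apply/qg_piP; rewrite qg_reprK. Qed.

Definition qg_one : quotient_group := qg_pi 1.
Definition qg_mul (x y : quotient_group) : quotient_group :=
  qg_pi (qg_repr x * qg_repr y).
Definition qg_inv (x : quotient_group) : quotient_group :=
  qg_pi (qg_repr x)^-1.

Lemma qg_mul_pi x y : qg_mul (qg_pi x) (qg_pi y) = qg_pi (x * y).
Proof.
apply/qg_piP; case: (nsgP N) => _ hM _ hJ.
set x' := qg_repr (qg_pi x); set y' := qg_repr (qg_pi y).
have -> : (x' * y')^-1 * (x * y) = (x'^-1 * x) ^ y' * (y'^-1 * y).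
  by rewrite /conjg invMg !mulgA mulgK.
by apply: hM; [apply: hJ|]; apply: qg_pi_repr.
Qed.

Lemma qg_inv_pi x : qg_inv (qg_pi x) = qg_pi x^-1.
Proof.
apply/qg_piP; case: (nsgP N) => _ _ hV hJ.
set x' := qg_repr (qg_pi x).
have -> : x'^-1^-1 * x^-1 = ((x'^-1 * x)^-1) ^ (x'^-1).
  by rewrite /conjg invMg !invgK !mulgA mulgK.
by apply: hJ; apply: hV; apply: qg_pi_repr.
Qed.

Lemma qg_mulA : associative qg_mul.
Proof.
move=> x y z; rewrite -(qg_reprK x) -(qg_reprK y) -(qg_reprK z).
by rewrite !qg_mul_pi mulgA.
Qed.

Lemma qg_mul1 : left_id qg_one qg_mul.
Proof. by move=> x; rewrite -(qg_reprK x) qg_mul_pi mul1g. Qed.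

Lemma qg_mulr1 : right_id qg_one qg_mul.
Proof. by move=> x; rewrite -(qg_reprK x) qg_mul_pi mulg1. Qed.

Lemma qg_mulV : left_inverse qg_one qg_inv qg_mul.
Proof. by move=> x; rewrite -(qg_reprK x) qg_inv_pi qg_mul_pi mulVg. Qed.

Lemma qg_mulrV : right_inverse qg_one qg_inv qg_mul.
Proof. by move=> x; rewrite -(qg_reprK x) qg_inv_pi qg_mul_pi mulgV. Qed.

HB.instance Definition _ := isGroup.Build quotient_group
  qg_mulA qg_mul1 qg_mulr1 qg_mulV qg_mulrV.

End QuotientGroup.

Definition edge_commutators (I : finType) (e : rel I) (F : I -> finGroupType) :
    set (free_product F) :=
  [set x | exists i j (a : F i) (b : F j),
             e i j /\ x = [~ fp_inj a, fp_inj b]].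

Arguments edge_commutators {I} e F.

Definition graph_product (I : finType) (e : rel I) (F : I -> finGroupType) :
    groupType :=
  quotient_group (normal_closure (edge_commutators e F)).

Definition simplicial_graph (I : finType) (e : rel I) : Prop :=
  symmetric e /\ irreflexive e.

(* 0 if [P] is empty *)
Definition least (P : set nat) : nat :=
  xget 0%N [set n | P n /\ forall k, P k -> (n <= k)%N].

Section WordMetric.
Variables (G : groupType) (S : set G).

Definition spells (s : seq G) (g : G) : Prop :=
  (forall h, h \in s -> S h \/ S h^-1) /\ \prod_(h <- s) h = g.

Definition generates : Prop := forall g, exists s, spells s g.

Definition word_length (g : G) : nat :=
  least [set n | exists2 s, spells s g & size s = n].

Definition word_metric (g h : G) : nat := word_length (g^-1 * h).

End WordMetric.

Definition face (n : nat) (f : 'I_n -> option bool) : set {ffun 'I_n -> bool} :=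
  [set x | forall i b, f i = Some b -> x i = b].

(* Cubes are embedded and any two of them meet in a common face or not at all,
   as in Bridson--Haefliger, Definition I.7.32; this loses no CAT(0) cube
   complex.  Such a complex is determined by the vertex sets of its cubes, so
   cubes, faces and subcomplexes are represented by their vertex sets.
   [face f] runs over the nonempty faces of the cube [0,1]^n. *)
Record cube_complex : Type := CubeComplex {
  vertex :> Type;
  cube : set (set vertex);
  cube_vertex : forall x, cube [set x];
  cube_chart : forall C, cube C ->
    exists (n : nat) (c : {ffun 'I_n -> bool} -> vertex),
      [/\ injective c, C = range c
        & forall D, D `<=` C -> (cube D <-> exists f, D = c @` face f)];
  cube_meet : forall C D, cube C -> cube D ->
    C `&` D = set0 \/ cube (C `&` D) }.

Arguments cube {_}.

Section CubeComplexTheory.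
Variable X : cube_complex.
Implicit Types x y z w m : X.

Definition adjacent x y : Prop := x <> y /\ cube [set x; y].

Definition edge_path x (p : seq X) y : Prop :=
  path (fun a b => `[< adjacent a b >]) x p /\ last x p = y.

Definition dist x y : nat :=
  least [set n | exists2 p, edge_path x p y & size p = n].

Definition geodesic x (p : seq X) y : Prop :=
  edge_path x p y /\ size p = dist x y.

Definition on_geodesic x y m : Prop :=
  exists p q, geodesic x (p ++ q) y /\ last x p = m.

Definition is_median x y z m : Prop :=
  [/\ on_geodesic x y m, on_geodesic y z m & on_geodesic x z m].

Definition connected_complex : Prop := forall x y, exists p, edge_path x p y.

(* [x], [y], [z], [w] in cyclic order *)
Definition square x y z w : Prop :=
  [/\ cube [set t | [\/ t = x, t = y, t = z | t = w]],
      adjacent x y /\ adjacent y z, adjacent z w /\ adjacent w x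
    & x <> z /\ y <> w].

Inductive path_step : seq X -> seq X -> Prop :=
| path_backtrack p q x y : adjacent x y ->
    path_step (p ++ [:: x, y, x & q]) (p ++ x :: q)
| path_square p q x y z w : square x y z w ->
    path_step (p ++ [:: x, y, z & q]) (p ++ [:: x, w, z & q]).

Definition path_homotopic : seq X -> seq X -> Prop :=
  clos_refl_sym_trans _ path_step.

(* Triviality of the edge-path group of the 2-skeleton. *)
Definition simply_connected : Prop :=
  connected_complex /\
  forall x p, edge_path x p x -> path_homotopic (x :: p) [:: x].

(* The vertices of the link of [x] are the edges at [x], represented by their
   other endpoints; each cube containing [x] contributes a simplex. *)
Definition link_simplex x (A : set X) : Prop :=
  exists C, [/\ cube C, C x & A = [set y | C y /\ adjacent x y]].

Definition flag_links : Prop :=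
  forall x (A : set X), finite_set A ->
    (forall y, A y -> adjacent x y) ->
    (forall y z, A y -> A z -> y <> z -> link_simplex x [set y; z]) ->
    link_simplex x A.

(* Gromov's combinatorial form of the CAT(0) condition *)
Definition CAT0 : Prop := simply_connected /\ flag_links.

End CubeComplexTheory.

Record cubical_action (G : groupType) (X : cube_complex) : Type :=
  CubicalAction {
    act :> G -> X -> X;
    act1 : forall x, act 1 x = x;
    actM : forall g h x, act (g * h) x = act g (act h x);
    act_cube : forall g C, cube C -> cube (act g @` C) }.

Section Cubulations.
Variables (G : groupType) (X : cube_complex) (a : cubical_action G X).

(* Proper discontinuity: every compact set lies in a finite subcomplex, and
   two subcomplexes meet if and only if they share a vertex. *)
Definition proper_action : Prop :=
  forall K : set X, finite_set K -> finite_set [set g | exists2 x, K x & K (a g x)].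

Definition cocompact_action : Prop :=
  exists K : set (set X), [/\ finite_set K, K `<=` cube
    & forall C, cube C -> exists g, exists2 D, K D & C = a g @` D].

Definition cocompact_cubulation : Prop :=
  [/\ CAT0 X, proper_action & cocompact_action].

Definition strongly_cellular : Prop :=
  forall g C, cube C -> a g @` C = C -> forall x, C x -> a g x = x.

Definition cubical_coarse_median (v : X) (mu : G -> G -> G -> G) : Prop :=
  exists N : nat, forall g1 g2 g3 m,
    is_median (a g1 v) (a g2 v) (a g3 v) m ->
    (dist (a (mu g1 g2 g3) v) m <= N)%N.

End Cubulations.

Definition same_coarse_median_structure (G : groupType) (X Y : cube_complex)
    (aX : cubical_action G X) (aY : cubical_action G Y) : Prop :=
  forall (v : X) (w : Y) (muX muY : G -> G -> G -> G),
    cubical_coarse_median aX v muX -> cubical_coarse_median aY w muY ->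
    forall S : set G, finite_set S -> generates S ->
    exists N : nat, forall g1 g2 g3,
      (word_metric S (muX g1 g2 g3) (muY g1 g2 g3) <= N)%N.

(* Main.v *)
Require Import Defs.
From mathcomp Require Import all_boot all_fingroup.
From mathcomp Require Import all_classical zify.

Set Implicit Arguments.
Unset Strict Implicit.
Unset Printing Implicit Defensive.

(** A triple median lies between any two of its points, so it suffices to show
    that an intrinsic family of subsets of the group is quasiconvex for every
    strongly cellular cocompact cubulation [X].

    For a vertex [v] of the graph, let [St v] be the subgroup generated by [F v]
    and its neighbours. Along a path in the Cayley graph, record the product of
    the letters of [F v] by which it crosses a coset [t St v], which we call a
    wall: this is a cocycle, so its value depends on the end points only, and the
    group is divided into the sides of the wall. A shortest word crosses no wall
    twice, hence two elements that are far apart are separated by a wall far from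
    both of them.

    In [X], the finite group [F v] has a nonempty, convex fixed point set, because
    the action is strongly cellular, and [St v] acts coboundedly on it, because
    the centralizer of [F v] lies in [St v]. A geodesic that leaves one side of the
    wall [St v] and comes back does so near this convex set, so it never goes far
    from that side. If the two coarse medians of [g1], [g2], [g3] were far apart,
    they would be separated by a wall far from both; two of the three points are on
    the same side, and the median on the other side is too close to the wall.

    The geometry of [X] rests on the solution of the word problem for edge paths of
    a CAT(0) cube complex: up to flipping squares, a path is determined by
    its end points once no flips make a backtrack appear. *)

Local Open Scope classical_set_scope.

(** * Cubes and squares *)

Section Charts.
Variable X : cube_complex.
Implicit Types (x y z w : X) (C : set X).

Definition toggle n (e : {ffun 'I_n -> bool}) (i : 'I_n) : {ffun 'I_n -> bool} :=
  [ffun j => if j == i then ~~ e j else e j].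

Lemma toggleK n i : involutive (fun e : {ffun 'I_n -> bool} => toggle e i).
Proof. by move=> e; apply/ffunP => j; rewrite !ffunE; case: eqP => //; rewrite negbK. Qed.

Lemma toggleC n (e : {ffun 'I_n -> bool}) i j :
  toggle (toggle e i) j = toggle (toggle e j) i.
Proof. by apply/ffunP => k; rewrite !ffunE; case: eqP; case: eqP. Qed.

Lemma toggle_neq n (e : {ffun 'I_n -> bool}) i : toggle e i <> e.
Proof. by move/ffunP/(_ i); rewrite ffunE eqxx; case: (e i). Qed.

Lemma toggle_inj n (e : {ffun 'I_n -> bool}) : injective (toggle e).
Proof.
move=> i j /ffunP/(_ i); rewrite !ffunE eqxx; case: eqP => // _.
by case: (e i).
Qed.

Lemma adjacent_sym x y : adjacent x y -> adjacent y x.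
Proof.
move=> [nxy Cxy]; split; first exact: nesym.
by rewrite setUC.
Qed.

Definition chart C n (c : {ffun 'I_n -> bool} -> X) : Prop :=
  [/\ injective c, C = range c
    & forall D : set X, D `<=` C -> (cube D <-> exists f, D = c @` face f)].

Section Chart.
Variables (C : set X) (n : nat) (c : {ffun 'I_n -> bool} -> X).
Hypothesis cC : chart C c.

Lemma chart_in e : C (c e).
Proof. by case: cC => _ -> _; exists e. Qed.

Lemma chart_ex x : C x -> exists e, x = c e.
Proof. by case: cC => _ -> _ [e _ <-]; exists e. Qed.

Lemma chart_inj : injective c. Proof. by case: cC. Qed.

Lemma chart_adj e i : adjacent (c e) (c (toggle e i)).
Proof.
case: cC => injc defC faceP; split.
  by move/injc => E; case: (@toggle_neq _ e i).
apply/faceP.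
  by move=> x [->|->]; apply: chart_in.
exists (fun j => if j == i then None else Some (e j)).
apply/seteqP; split=> x.
  case=> ->; [exists e|exists (toggle e i)] => // j b.
    by case: eqP => // _ [].
  by rewrite ffunE; case: eqP => // _ [].
case=> e' fe' <-.
have [E|NE] := eqVneq (e' i) (e i).
  left; congr c; apply/ffunP => j.
  have [->//|ji] := eqVneq j i.
  by apply: fe'; rewrite (negbTE ji).
right; congr c; apply/ffunP => j; rewrite ffunE.
have [->|ji] := eqVneq j i.
  by case: (e' i) (e i) NE => [] [].
by apply: fe'; rewrite (negbTE ji).
Qed.

Lemma chart_nbr e y : C y -> adjacent (c e) y -> exists i, y = c (toggle e i).
Proof.
case: cC => injc defC faceP Cy [ney Cey].
have /faceP[//|f Ef] := Cey.
  by move=> x [->//|->//]; apply: chart_in.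
have [e' y_e'] := chart_ex Cy.
have fe : face f e.
  have : [set c e; y] (c e) by left.
  by rewrite Ef => -[e1 fe1 /injc <-].
have fe' : face f e'.
  have : [set c e; y] y by right.
  by rewrite Ef y_e' => -[e1 fe1 /injc <-].
have [i ei] : exists i, e i != e' i.
  apply: contrapT => h; apply: ney; rewrite y_e'; congr c; apply/ffunP => i.
  by apply/eqP/negPn/negP => hi; apply: h; exists i.
exists i.
have : [set c e; y] (c (toggle e i)).
  rewrite Ef; exists (toggle e i) => // j b fj; rewrite ffunE.
  have [ji|_] := eqVneq j i; last exact: fe fj.
  by move: ei; rewrite -ji (fe _ _ fj) (fe' _ _ fj) eqxx.
by case=> [/injc/toggle_neq|->].
Qed.

Lemma chart_square e i j : i <> j ->
  square (c e) (c (toggle e i)) (c (toggle (toggle e i) j)) (c (toggle e j)).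
Proof.
move=> nij; case: cC => injc defC faceP.
split; last 1 first.
- split.
    move/injc/ffunP/(_ i); rewrite !ffunE eqxx; case: eqP => // _.
    by case: (e i).
  by move/injc/toggle_inj.
- apply/faceP.
    by move=> x []-> ; apply: chart_in.
  exists (fun k => if (k == i) || (k == j) then None else Some (e k)).
  apply/seteqP; split=> x.
    case=> ->; (eexists; [|reflexivity]) => k b; rewrite ?ffunE;
    by case: (k == i); case: (k == j) => //= -[].
  case=> e' fe' <-.
  have fk k : k != i -> k != j -> e' k = e k.
    by move=> ki kj; apply: fe'; rewrite (negbTE ki) (negbTE kj).
  have neg (a b : bool) : a != b -> a = ~~ b by case: a b => [] [].
  have nji : j == i = false by apply/eqP; exact: nesym.
  have nij' : i == j = false by apply/eqP.
  have [Ei|NEi] := eqVneq (e' i) (e i); have [Ej|NEj] := eqVneq (e' j) (e j).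
  + apply: Or41; congr c; apply/ffunP => k.
    have [->//|ki] := eqVneq k i; have [->//|kj] := eqVneq k j; exact: fk.
  + apply: Or44; congr c; apply/ffunP => k; rewrite ffunE.
    have [->|kj] := eqVneq k j; first exact: neg.
    have [->//|ki] := eqVneq k i; exact: fk.
  + apply: Or42; congr c; apply/ffunP => k; rewrite ffunE.
    have [->|ki] := eqVneq k i; first exact: neg.
    have [->//|kj] := eqVneq k j; exact: fk.
  + apply: Or43; congr c; apply/ffunP => k; rewrite !ffunE.
    have [->|kj] := eqVneq k j; first by rewrite nji; exact: neg.
    have [->|ki] := eqVneq k i; first exact: neg.
    exact: fk.
- split; exact: chart_adj.
- split.
    by rewrite toggleC; apply: adjacent_sym; apply: chart_adj.
  by apply: adjacent_sym; apply: chart_adj.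
Qed.

Lemma chart_opposite e y z w i j :
  C z -> y = c (toggle e i) -> w = c (toggle e j) -> i <> j ->
  adjacent y z -> adjacent z w -> z <> c e -> z = c (toggle (toggle e i) j).
Proof.
move=> Cz -> -> nij yz /adjacent_sym wz zx.
have injc := chart_inj.
have [k zk] := chart_nbr Cz yz; have [l zl] := chart_nbr Cz wz.
have nji : j == i = false by apply/eqP; exact: nesym.
have nij' : i == j = false by apply/eqP.
have nki : i == k = false.
  by apply/eqP => E; apply: zx; rewrite zk -E toggleK.
move: zl; rewrite zk => /injc/ffunP E.
have := E i; rewrite !ffunE eqxx nki nij'.
have [il _|_] := eqVneq i l; last by case: (e i).
have := E j; rewrite -il !ffunE eqxx nji.
by have [<-|_] := eqVneq j k => //; case: (e j).
Qed.

End Chart.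

(** The intersection with [C] is a face of the square containing both neighbours of [x], so no
    coordinate is fixed in it. *)
Lemma square_sub C x y z w :
  cube C -> square x y z w -> C x -> C y -> C w -> C z.
Proof.
move=> CC [cS [xy yz] [zw wx] [nxz nyw]] Cx Cy Cw.
set S := [set t | _] in cS.
have [n [c cC]] := cube_chart cS.
have Sx : S x by apply: Or41.
have Sy : S y by apply: Or42.
have Sz : S z by apply: Or43.
have Sw : S w by apply: Or44.
have [e xe] := chart_ex cC Sx.
have [i yi] : exists i, y = c (toggle e i) by apply: (chart_nbr cC) => //; rewrite -xe.
have [j wj] : exists i, w = c (toggle e i).
  by apply: (chart_nbr cC) => //; rewrite -xe; apply: adjacent_sym.
have nij : i <> j by move=> E; apply: nyw; rewrite yi wj E.
have zE : z = c (toggle (toggle e i) j).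
  by apply: (chart_opposite cC Sz yi wj) => //; rewrite -xe; exact: nesym.
have [E|cSC] := cube_meet cS CC.
  have : (S `&` C) x by [].
  by rewrite E.
case: (cC) => injc _ /(_ (S `&` C)) [|h _]; first by move=> ? [].
have [f Ef] := h cSC.
have inf e' : C (c e') -> S (c e') -> face f e'.
  move=> h1 h2; have : (S `&` C) (c e') by [].
  by rewrite Ef => -[e1 fe1 /injc <-].
have fi : face f (toggle e i) by apply: inf; rewrite -yi.
have fj : face f (toggle e j) by apply: inf; rewrite -wj.
have : (S `&` C) z; last by case.
rewrite Ef zE; exists (toggle (toggle e i) j) => // k b fk.
have := fi _ _ fk; have := fj _ _ fk; rewrite !ffunE.
by have [->|//] := eqVneq k j; have [E|//] := eqVneq j i; case: nij.
Qed.

Lemma square_flip x y z w : square x y z w -> square x w z y.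
Proof.
move=> [cS [xy yz] [zw wx] [nxz nyw]]; split.
- have -> // : [set t | [\/ t = x, t = w, t = z | t = y]] =
    [set t | [\/ t = x, t = y, t = z | t = w]].
  by apply/seteqP; split=> t [] ->; [apply: Or41|apply: Or44|apply: Or43|apply: Or42
    |apply: Or41|apply: Or44|apply: Or43|apply: Or42].
- by split; apply: adjacent_sym.
- by split; apply: adjacent_sym.
- by split=> //; exact: nesym.
Qed.

Lemma square_rot x y z w : square x y z w -> square y z w x.
Proof.
move=> [cS [xy yz] [zw wx] [nxz nyw]]; split=> //.
- have -> // : [set t | [\/ t = y, t = z, t = w | t = x]] =
    [set t | [\/ t = x, t = y, t = z | t = w]].
  by apply/seteqP; split=> t [] ->; [apply: Or42|apply: Or43|apply: Or44|apply: Or41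
    |apply: Or44|apply: Or41|apply: Or42|apply: Or43].
- by split=> //; exact: nesym.
Qed.

Lemma square_adj x y z w : square x y z w -> adjacent x y.
Proof. by move=> [_ []]. Qed.

Lemma square_uniq x y z z' w : square x y z w -> square x y z' w -> z = z'.
Proof.
move=> s s'; have [cS' _ _ _] := s'.
have : [set t | [\/ t = x, t = y, t = z' | t = w]] z.
  by apply: (square_sub cS' s); [apply: Or41|apply: Or42|apply: Or44].
have [_ [_ [nyz _]] [[nzw _] _] [nxz _]] := s.
by case=> // E; [case: nxz|case: nyz].
Qed.

Lemma square_diag x y z w : square x y z w -> ~ adjacent x z.
Proof.
move=> [cS [xy yz] [zw wx] [nxz nyw]] xz.
set S := [set t | _] in cS.
have [n [c cC]] := cube_chart cS.
have Sx : S x by apply: Or41.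
have Sy : S y by apply: Or42.
have Sz : S z by apply: Or43.
have [e xe] := chart_ex cC Sx.
have [i yi] : exists i, y = c (toggle e i) by apply: (chart_nbr cC) => //; rewrite -xe.
have [j zj] : exists i, z = c (toggle e i) by apply: (chart_nbr cC) => //; rewrite -xe.
have [nyz _] := yz; move: yz; rewrite yi => /(chart_nbr cC Sz)[k]; rewrite zj => /(chart_inj cC)/ffunP E.
have [ij|nij] := eqVneq i j.
  by case: nyz; rewrite yi zj ij.
have nji : j == i = false by rewrite eq_sym (negbTE nij).
have := E i; rewrite !ffunE eqxx (negbTE nij).
have [ik _|_] := eqVneq i k; last by case: (e i).
have := E j; rewrite -ik !ffunE eqxx nji.
by case: (e j).
Qed.

Lemma square_link x y z w : square x y z w -> link_simplex x [set y; w].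
Proof.
move=> s; have [cS [xy yz] [zw wx] _] := s.
exists [set t | [\/ t = x, t = y, t = z | t = w]]; split=> //; first exact: Or41.
apply/seteqP; split=> t.
  by case=> ->; split=> //; [apply: Or42|apply: Or44|apply: adjacent_sym].
by case=> -[->|->|->|->] [] //; [left|move=> h1 h2; case: (square_diag s); split|right].
Qed.

(** The squares make [y1], [y2], [y3] pairwise adjacent in the link of [x], so flagness yields a
    cube through them; toggling the three coordinates at [x] gives [e]. *)
Lemma flag_cube3 x y1 y2 y3 z12 z13 z23 :
  flag_links X ->
  square x y1 z12 y2 -> square x y1 z13 y3 -> square x y2 z23 y3 ->
  exists e, [/\ square y1 z12 e z13, square y2 z12 e z23 & square y3 z13 e z23].
Proof.
move=> fl s12 s13 s23.
have a1 := square_adj s12.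
have a2 := square_adj s23.
have a3 := square_adj (square_flip s23).
have [_ _ _ [_ n12]] := s12; have [_ _ _ [_ n13]] := s13; have [_ _ _ [_ n23]] := s23.
have := fl x [set t | [\/ t = y1, t = y2 | t = y3]].
case=> [|y|y z|C [cC Cx CE]].
- have -> : [set t | [\/ t = y1, t = y2 | t = y3]] = [set y1] `|` [set y2] `|` [set y3].
    apply/seteqP; split=> t; first by case=> ->; [left; left|left; right|right].
    by case=> [[->|->]|->]; [apply: Or31|apply: Or32|apply: Or33].
  by rewrite !finite_setU; do !split; exact: finite_set1.
- by case=> ->.
- have l12 := square_link s12; have l13 := square_link s13; have l23 := square_link s23.
  by case=> -> [] -> // _; rewrite // setUC.
have [n [c ch]] := cube_chart cC.
have [e xe] := chart_ex ch Cx.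
have nb y : [\/ y = y1, y = y2 | y = y3] -> exists i, y = c (toggle e i).
  move=> h; have : [set t | [\/ t = y1, t = y2 | t = y3]] y by [].
  by rewrite CE => -[Cy xy]; apply: (chart_nbr ch) => //; rewrite -xe.
have [i1 E1] := nb y1 (Or31 _ _ erefl).
have [i2 E2] := nb y2 (Or32 _ _ erefl).
have [i3 E3] := nb y3 (Or33 _ _ erefl).
have n12' : i1 <> i2 by move=> E; apply: n12; rewrite E1 E2 E.
have n13' : i1 <> i3 by move=> E; apply: n13; rewrite E1 E3 E.
have n23' : i2 <> i3 by move=> E; apply: n23; rewrite E2 E3 E.
have Z12 : z12 = c (toggle (toggle e i1) i2).
  by apply: (square_uniq s12); rewrite xe E1 E2; apply: (chart_square ch).
have Z13 : z13 = c (toggle (toggle e i1) i3).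
  by apply: (square_uniq s13); rewrite xe E1 E3; apply: (chart_square ch).
have Z23 : z23 = c (toggle (toggle e i2) i3).
  by apply: (square_uniq s23); rewrite xe E3 E2; apply: (chart_square ch).
exists (c (toggle (toggle (toggle e i1) i2) i3)).
rewrite E1 E2 E3 Z12 Z13 Z23; split.
- exact: (chart_square ch).
- by rewrite (toggleC e i1); apply: (chart_square ch).
- rewrite (toggleC e i1 i3) (toggleC e i2 i3) (toggleC (toggle e i1) i2) (toggleC e i1).
  exact: (chart_square ch).
Qed.

End Charts.

Ltac square_symmetry :=
  match goal with H : square _ _ _ _ |- square _ _ _ _ =>
    solve [ exact H | exact (square_rot H) | exact (square_rot (square_rot H))
          | exact (square_rot (square_rot (square_rot H)))
          | exact (square_flip H) | exact (square_rot (square_flip H))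
          | exact (square_rot (square_rot (square_flip H)))
          | exact (square_rot (square_rot (square_rot (square_flip H)))) ]
  end.

(** * Flipping squares in edge paths *)

Section Flips.
Variable X : cube_complex.
Implicit Types (x y z w a b c d : X) (s l r q : seq X).

Inductive flip : seq X -> seq X -> Prop :=
| flip_refl s : flip s s
| flip_trans s1 s2 s3 : flip s1 s2 -> flip s2 s3 -> flip s1 s3
| flip_cons x s s' : flip s s' -> flip (x :: s) (x :: s')
| flip_square x y z w s : square x y z w ->
    flip (x :: y :: z :: s) (x :: w :: z :: s).

Lemma flip_sym s s' : flip s s' -> flip s' s.
Proof.
elim=> {s s'}.
- by move=> s; apply: flip_refl.
- by move=> s1 s2 s3 _ h1 _ h2; apply: flip_trans h2 h1.
- by move=> x s s' _; apply: flip_cons.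
- by move=> x y z w s /square_flip; apply: flip_square.
Qed.

Lemma flip_size s s' : flip s s' -> size s = size s'.
Proof. by elim=> {s s'} //= [s1 s2 s3 _ -> _ ->|x s s' _ ->]. Qed.

Lemma flip_consE x s t : flip (x :: s) t -> exists s', t = x :: s'.
Proof.
move: {-1}(x :: s) (erefl (x :: s)) => u E h; elim: h x s E => {u t}.
- by move=> s x s' <-; exists s'.
- by move=> s1 s2 s3 _ IH1 _ IH2 x s /IH1[s' E]; apply: IH2 (esym E).
- by move=> x s s' _ _ y t [-> _]; exists s'.
- by move=> x y z w s _ x' s' [-> _]; eexists.
Qed.

Lemma flip_last x s s' : flip s s' -> last x s = last x s'.
Proof.
by move=> h; elim: h x => {s s'} //= s1 s2 s3 _ h1 _ h2 x; rewrite h1.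
Qed.

Fixpoint walk s : Prop :=
  if s is x :: s' then (if s' is y :: _ then adjacent x y else True) /\ walk s'
  else True.

Lemma flip_walk s s' : flip s s' -> walk s -> walk s'.
Proof.
elim=> {s s'} //.
- by move=> s1 s2 s3 _ h1 _ h2 /h1/h2.
- move=> x [|y s] s' h IH; first by case: s' h {IH} => // ? ? /flip_size.
  by have [t Et] := flip_consE h; move: IH; rewrite Et /= => IH [hx /IH].
- move=> x y z w s h /= [_ [_ hz]].
  split; first exact: square_adj (square_flip h).
  by split=> //; exact: square_adj (square_rot (square_flip h)).
Qed.

Hypothesis flX : flag_links X.

(* The last edges of two flip equivalent walks, read from the head, either
   agree or are the two top edges of a square. *)
Definition head_related y s s' : Prop :=
  flip s s' \/ exists a b c r,
    [/\ square y a c b, flip s (a :: c :: r) & flip s' (b :: c :: r)].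

(** The main case is two successive squares at [y] sharing the corner [a1]. By induction their far
    corners [c0] and [c1] agree, and then [a0 = a2], or they span a square at [a1], and then
    [flag_cube3] provides a cube whose face at [y] relates the outer walks. *)
Lemma head_related_trans n :
  (forall y s s', (size s < n)%N -> flip (y :: s) (y :: s') -> head_related y s s') ->
  forall y s1 s2 s3, (size s1 <= n)%N ->
  head_related y s1 s2 -> head_related y s2 s3 -> head_related y s1 s3.
Proof.
move=> IH y s1 s2 s3 sz [h12|[a0 [a1 [c0 [r0 [sq0 h1 h2]]]]]].
  case=> [h23|[a1 [a2 [c1 [r1 [sq1 h2 h3]]]]]]; first by left; apply: flip_trans h23.
  by right; exists a1, a2, c1, r1; split=> //; apply: flip_trans h2.
case=> [h23|[a1' [a2 [c1 [r1 [sq1 h2' h3]]]]]].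
  right; exists a0, a1, c0, r0; split=> //.
  exact: flip_trans (flip_sym h23) h2.
have hm : flip (a1 :: c0 :: r0) (a1' :: c1 :: r1) := flip_trans (flip_sym h2) h2'.
have Ea : a1' = a1 by have [? [->]] := flip_consE hm.
rewrite {}Ea {a1'} in sq1 h2' hm.
have [|hf|[b0 [b1 [d [r [sqd e0 e1]]]]]] := IH _ _ _ _ hm.
- by move: sz; rewrite (flip_size h1) /=; lia.
- have Ec : c1 = c0 by have [? [->]] := flip_consE hf.
  rewrite {}Ec {c1} in sq1 h2' h3 hf hm.
  have E : a0 = a2.
    by apply: (square_uniq (square_rot (square_rot (square_rot sq0))));
       apply: (square_rot (square_rot (square_rot (square_flip sq1)))).
  left; apply: flip_trans h1 _; apply: flip_trans (flip_sym h3).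
  by rewrite E; apply: flip_cons.
- have E0 : b0 = c0 by have [? [->]] := flip_consE e0.
  have E1 : b1 = c1 by have [? [->]] := flip_consE e1.
  rewrite {}E0 {}E1 {b0 b1} in sqd e0 e1.
  have [e [q0 q1 q2]] := flag_cube3 flX (square_rot (square_rot (square_rot sq0)))
    (square_flip (square_rot sq1)) sqd.
  right; exists a0, a2, e, (d :: r); split=> //.
    apply: flip_trans h1 _; apply: flip_trans (flip_cons _ e0) _.
    exact/flip_square/square_rot/square_rot/square_rot/square_flip.
  apply: flip_trans h3 _; apply: flip_trans (flip_cons _ e1) _.
  exact/flip_square/square_rot/square_rot/square_rot/square_flip.
Qed.

Lemma flip_head y s s' : flip (y :: s) (y :: s') -> head_related y s s'.
Proof.
have [n] := ubnP (size s); elim: n y s s' => // n IH y s s' sz.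
move: {-1}(y :: s) (erefl (y :: s)) => l El; move: {-1}(y :: s') (erefl (y :: s')) => l' El' h.
elim: h y s s' El El' sz => {l l'}.
- by move=> s y s1 s2 <- [<-] _; left; apply: flip_refl.
- move=> s1 s2 s3 h12 IH1 h23 IH2 y t1 t3 E1 E3 sz.
  rewrite -E1 in h12; have [t2 E2] := flip_consE h12.
  apply: (@head_related_trans n) (IH1 _ _ _ E1 (esym E2) sz) (IH2 _ _ _ (esym E2) E3 _) => //.
  by have := flip_size h12; rewrite E2 /= => -[<-].
- by move=> x s s' h _ y t t' [_ ->] [_ ->] _; left.
- move=> x y z w s sq y' t t' [-> ->] [->] _; right.
  by exists y, w, z, s; split=> //; apply: flip_refl.
Qed.

Lemma flip_cancel y a p q :
  flip (y :: a :: p) (y :: a :: q) -> flip (a :: p) (a :: q).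
Proof.
case/flip_head => // -[a1 [b1 [c [r [sq h1 h2]]]]].
have Ea : a1 = a by have [? [->]] := flip_consE h1.
have Eb : b1 = a by have [? [->]] := flip_consE h2.
by case: sq => _ _ _ [_]; rewrite Ea Eb.
Qed.

Lemma flip_diamond y a b p q : a <> b -> flip (y :: a :: p) (y :: b :: q) ->
  exists c r, [/\ square y a c b, flip (a :: p) (a :: c :: r)
                & flip (b :: q) (b :: c :: r)].
Proof.
move=> nab /flip_head[/flip_consE[? []]|[a1 [b1 [c [r [sq h1 h2]]]]]].
  by move/esym.
have Ea : a1 = a by have [? [->]] := flip_consE h1.
have Eb : b1 = b by have [? [->]] := flip_consE h2.
by exists c, r; rewrite -{1 3}Ea -{1 3}Eb.
Qed.

Inductive backtracks : seq X -> Prop :=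
| backtracks_here x y s : backtracks (x :: y :: x :: s)
| backtracks_cons x s : backtracks s -> backtracks (x :: s).

Definition reduced s : Prop := forall s', flip s s' -> ~ backtracks s'.

Lemma reduced_flip s s' : flip s s' -> reduced s -> reduced s'.
Proof. by move=> h rs t /(flip_trans h); apply: rs. Qed.

Lemma reduced_tl x s : reduced (x :: s) -> reduced s.
Proof. by move=> h t /(flip_cons x)/h nb bt; apply: nb; apply: backtracks_cons. Qed.

Lemma reduced_small s : (size s <= 2)%N -> reduced s.
Proof.
move=> sz t h bt; move: sz; rewrite (flip_size h) => {h}.
by elim: bt => //= x {}s _ IH sz; apply: IH; lia.
Qed.

(** Suppose the walk with a backtrack starts with [z], [a], where [a <> y], and let [c] be the
    fourth corner of the diamond at [z]. A backtrack at the head would produce one in [y :: s]; a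
    deeper one lets the induction put [a] after [c], and the square then turns [c] into [z]. *)
Lemma reduced_consN y z s : reduced (y :: s) -> ~ reduced (z :: y :: s) ->
  exists q, flip (y :: s) (y :: z :: q).
Proof.
have [n] := ubnP (size s); elim: n y z s => // n IH y z s sz ry.
move/existsNP => [t /not_implyP[h /contrapT bt]].
have [t1 Et] := flip_consE h; rewrite {}Et {t} in h bt.
case: t1 => [|a t] in h bt *; first by have := flip_size h.
have [E|nay] := pselect (a = y).
  rewrite {}E {a} in h bt.
  have h1 := flip_cancel h.
  move E : (z :: y :: t) bt => u bt; case: bt E => [x y' s' [E1 E2 Et]|x s' bt [_ Es']].
    by exists s'; subst x y' t.
  by case: (ry _ h1); rewrite Es'.
have [c [r [sq h1 h2]]] := flip_diamond (nesym nay) h.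
have rcr : reduced (c :: r) by apply: reduced_tl (reduced_flip h1 ry).
have szr : (size r < n)%N by have := flip_size h1; move: sz => /=; lia.
move E : (z :: a :: t) bt => u bt; case: bt E => [x y' s' [E1 E2 Et]|x s' bt [_ Es']].
  subst x y' t.
  have nzc : c <> z.
    by case: sq => _ _ _ [] /nesym.
  have [d [r' [sq' h3 h4]]] := flip_diamond nzc (flip_sym h2).
  have Ed : d = y.
    exact: square_uniq sq' (square_flip (square_rot (square_rot (square_rot sq)))).
  case: (ry (y :: c :: y :: r')); last exact: backtracks_here.
  by rewrite Ed in h3; apply: flip_trans h1 (flip_cons _ h3).
have [|q hq] := IH c a r szr rcr.
  by move/(_ (a :: t) (flip_sym h2)); apply; rewrite Es'.
exists (a :: q); apply: flip_trans h1 _; apply: flip_trans (flip_cons _ hq) _.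
exact: flip_square (square_rot sq).
Qed.

End Flips.

(** * Reduced forms and the word problem for edge paths *)

Section Steps.
Variable X : cube_complex.
Hypothesis flX : flag_links X.
Implicit Types (x y z w a b c d : X) (s l r q p : seq X).

Definition descends z l l' : Prop := exists y q, flip l (y :: z :: q) /\ l' = z :: q.

(* As in van der Waerden's trick, a new vertex either extends a reduced path or
   undoes its last edge; [run] then sends every path to the flip class of its
   reduced form, and is invariant under homotopy. *)
Definition step z l : seq X :=
  if pselect (exists l', descends z l l') is left e then projT1 (cid e) else z :: l.

(** By [flip_cancel], the choice made in [step] does not matter up to flips. *)
Lemma step_down y z l q : flip l (y :: z :: q) -> flip (step z l) (z :: q).
Proof.
move=> h; rewrite /step; case: pselect => [e|[]]; last by exists (z :: q), y, q.
case: (cid e) => /= l' [y' [q' [h' ->]]].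
have hh := flip_trans (flip_sym h') h.
by have [? [Ey _]] := flip_consE hh; rewrite Ey in hh; apply: flip_cancel hh.
Qed.

Lemma step_up z l : (forall y q, ~ flip l (y :: z :: q)) -> step z l = z :: l.
Proof.
move=> h; rewrite /step; case: pselect => // e.
by have [l' [y [q [/h]]]] := e.
Qed.

Lemma stepP z l : (exists y q, flip l (y :: z :: q) /\ flip (step z l) (z :: q)) \/
  ((forall y q, ~ flip l (y :: z :: q)) /\ step z l = z :: l).
Proof.
have [[y [q h]]|h] := pselect (exists y q, flip l (y :: z :: q)).
  by left; exists y, q; split=> //; apply: step_down h.
have h' y q : ~ flip l (y :: z :: q) by move=> hh; apply: h; exists y, q.
by right; split=> //; apply: step_up.
Qed.

Lemma step_flip z l l' : flip l l' -> flip (step z l) (step z l').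
Proof.
move=> h; have [[y [q [hl e]]]|[nl ->]] := stepP z l.
  apply: flip_trans e _; apply: flip_sym.
  by apply: step_down; apply: flip_trans (flip_sym h) hl.
rewrite step_up; first exact: flip_cons.
by move=> y q /(flip_trans h); apply: nl.
Qed.

Lemma step_head z l : exists t, step z l = z :: t.
Proof.
have [[y [q [_ /flip_sym/flip_consE]]]|[_ ->]] := stepP z l; first by [].
by exists l.
Qed.

Lemma step_reduced z l : reduced l -> reduced (step z l).
Proof.
move=> rl; have [[y [q [hl e]]]|[nl ->]] := stepP z l.
  by apply: reduced_flip (flip_sym e) _; apply: reduced_tl (reduced_flip hl rl).
case: l rl nl => [|y s] rl nl; first exact: reduced_small.
by apply: contrapT => /(reduced_consN flX rl)[q /nl].
Qed.

(** If [z] descends, a second descent would exhibit the backtrack [y], [z], [y] in a reduced walk,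
    so [y] is pushed back; if [z] is pushed, [y] removes it. *)
Lemma step_back y z s : reduced (y :: s) -> flip (step y (step z (y :: s))) (y :: s).
Proof.
move=> rl; have [[y' [q [hl e]]]|[nl E]] := stepP z (y :: s).
  have [? [Ey _]] := flip_consE hl; rewrite {}Ey in hl.
  apply: flip_trans (step_flip _ e) _.
  rewrite step_up; first exact: flip_sym.
  move=> z' q' h; have [? [Ez _]] := flip_consE h; rewrite {}Ez in h.
  have := reduced_flip (flip_trans hl (flip_cons _ h)) rl.
  by move/(_ _ (flip_refl _)); apply; apply: backtracks_here.
by rewrite E; apply: step_down (flip_refl _).
Qed.

(** If [z'] descends too, the diamond at [y] has fourth corner [w], to which both sides descend. If
    [z'] is pushed, flipping the square shows that [w] descends after [z'], while after [z] it is
    pushed. *)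
Lemma step_square_aux y s z w z' : reduced (y :: s) -> square y z w z' ->
  (exists q, flip (y :: s) (y :: z :: q)) ->
  flip (step w (step z (y :: s))) (step w (step z' (y :: s))).
Proof.
move=> rl sq [q hz].
have nzz' : z <> z' by case: sq => _ _ _ [].
have nwy : w <> y by case: sq => _ _ _ [/nesym].
apply: flip_trans (step_flip _ (step_down hz)) _.
have [[y' [q' [hz' e]]]|[nl E]] := stepP z' (y :: s).
  have [? [Ey _]] := flip_consE hz'; rewrite {}Ey in hz'.
  have [c [r [sq' h1 h2]]] := flip_diamond flX nzz' (flip_trans (flip_sym hz) hz').
  have Ec : c = w := square_uniq sq' sq; rewrite {}Ec in sq' h1 h2.
  apply: flip_trans (step_down h1) _; apply: flip_sym.
  apply: flip_trans (step_flip _ e) _; exact: step_down h2.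
rewrite E.
have h : flip (z' :: y :: s) (z' :: w :: z :: q).
  apply: flip_trans (flip_cons _ hz) _.
  by apply: flip_square; square_symmetry.
apply: flip_sym; apply: flip_trans (step_down h) _.
rewrite step_up; first exact: flip_refl.
move=> z1 q1 h1; have [? [Ez _]] := flip_consE h1; rewrite {}Ez in h1.
apply: (nl y (w :: q1)); apply: flip_trans hz _; apply: flip_trans (flip_cons _ h1) _.
exact: flip_square sq.
Qed.

Lemma step_square y s z w z' : reduced (y :: s) -> square y z w z' ->
  flip (step w (step z (y :: s))) (step w (step z' (y :: s))).
Proof.
move=> rl sq; have sq' := square_flip sq.
have [hz|nz] := pselect (exists q, flip (y :: s) (y :: z :: q)).
  exact: step_square_aux rl sq hz.
have [hz'|nz'] := pselect (exists q, flip (y :: s) (y :: z' :: q)).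
  by apply: flip_sym; apply: step_square_aux rl sq' hz'.
have up t : ~ (exists q, flip (y :: s) (y :: t :: q)) -> step t (y :: s) = t :: y :: s.
  move=> nt; apply: step_up => y' q h; apply: nt.
  by have [? [Ey _]] := flip_consE h; exists q; rewrite -{2}Ey.
rewrite !up //.
have nyw : y <> w by case: sq => _ _ _ [].
(* After [t] is pushed, [w] is pushed as well: a descent would, by the diamond at [t], give a
   descent from [y] to [t']. *)
have upw t t' : square y t w t' -> ~ (exists q, flip (y :: s) (y :: t' :: q)) ->
    step w (t :: y :: s) = w :: t :: y :: s.
  move=> sqt nt'; apply: step_up => t1 q h.
  have [? [Et _]] := flip_consE h; rewrite {}Et in h.
  have [c [r [sqc h1 h2]]] := flip_diamond flX nyw h.
  apply: nt'; exists r; have -> // : t' = c.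
  by apply: (square_uniq _ sqc); square_symmetry.
rewrite (upw z z' sq nz') (upw z' z sq' nz).
by apply: flip_square; square_symmetry.
Qed.

Definition run s : seq X := foldr step [::] s.

Lemma run_reduced s : reduced (run s).
Proof. by elim: s => [|x s IH] /=; [apply: reduced_small|apply: step_reduced]. Qed.

Lemma run_flip p s s' : flip (run s) (run s') -> flip (run (p ++ s)) (run (p ++ s')).
Proof. by elim: p => //= x p IH /IH; apply: step_flip. Qed.

Lemma run_homotopic s s' : path_homotopic s s' -> flip (run s) (run s').
Proof.
elim=> {s s'}.
- move=> s s' [p q x y _|p q x y z w sq]; apply: run_flip => /=.
    have [t Et] := step_head x (run q).
    by rewrite Et; apply: step_back; rewrite -Et; apply/step_reduced/run_reduced.
  have [t Et] := step_head z (run q).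
  rewrite Et; apply: step_square; first by rewrite -Et; apply/step_reduced/run_reduced.
  square_symmetry.
- by move=> s; apply: flip_refl.
- by move=> s s' _; apply: flip_sym.
- by move=> s1 s2 s3 _ h1 _ h2; apply: flip_trans h1 h2.
Qed.

Lemma run_id s : reduced s -> flip (run s) s.
Proof.
elim: s => [|z s IH] rs; first exact: flip_refl.
apply: flip_trans (step_flip _ (IH (reduced_tl rs))) _.
rewrite step_up; first exact: flip_refl.
move=> y q h; apply: (rs (z :: y :: z :: q)); last exact: backtracks_here.
exact: flip_cons.
Qed.

Lemma path_homotopic_ctx p q s s' :
  path_homotopic s s' -> path_homotopic (p ++ s ++ q) (p ++ s' ++ q).
Proof.
elim=> {s s'}.
- move=> s s' h; apply: Relation_Operators.rst_step; case: h => [p' q' x y xy|p' q' x y z w sq].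
    by rewrite -!catA /= !(catA p); apply: path_backtrack.
  by rewrite -!catA /= !(catA p); apply: path_square.
- by move=> s; apply: Relation_Operators.rst_refl.
- by move=> s s' _; apply: Relation_Operators.rst_sym.
- by move=> s1 s2 s3 _ h1 _ h2; apply: Relation_Operators.rst_trans h1 h2.
Qed.

Lemma walk_path x p : walk (x :: p) <-> path (fun a b => `[< adjacent a b >]) x p.
Proof.
elim: p x => [|y p IH] x //=; split.
  by move=> [xy /IH h]; apply/andP; split=> //; apply/asboolP.
by move=> /andP[/asboolP xy /IH h].
Qed.

Lemma walk_cat s x s' : walk (rcons s x) -> walk (x :: s') -> walk (s ++ x :: s').
Proof.
elim: s => //= y s IH; case: s IH => [|z s] IH /= [yz h1] h2; first by [].
by split=> //; apply: IH.
Qed.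

Lemma walk_rcons s x y : walk (rcons (rcons s x) y) <-> walk (rcons s x) /\ adjacent x y.
Proof.
elim: s => [|z s IH] /=; first tauto.
case: s IH => [|z' s] IH; first by rewrite /=; tauto.
change (adjacent z z' /\ walk (rcons (rcons (z' :: s) x) y) <->
  (adjacent z z' /\ walk (rcons (z' :: s) x)) /\ adjacent x y).
by rewrite IH; tauto.
Qed.

Lemma walk_rev s : walk s -> walk (rev s).
Proof.
elim: s => // x s IH; case: s IH => // y s IH [xy /IH].
by rewrite !rev_cons => h; apply/walk_rcons; split=> //; apply: adjacent_sym.
Qed.

Lemma rev_homotopic x s : walk (x :: s) ->
  path_homotopic (rev (x :: s) ++ s) [:: last x s].
Proof.
elim: s x => [|y s IH] x; first by move=> _; apply: Relation_Operators.rst_refl.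
move=> [xy h]; apply: Relation_Operators.rst_trans (IH _ h).
rewrite !rev_cons -!cats1 -!catA /=.
apply: Relation_Operators.rst_step; apply: path_backtrack.
exact: adjacent_sym.
Qed.

(** Simple connectivity contracts the loop formed by one walk and the reverse of the other, so the
    walks are homotopic; [run] turns the homotopy into a flip and fixes reduced walks up to
    flips. *)
Lemma reduced_walk_flip y p p' : simply_connected X ->
  walk (y :: p) -> walk (y :: p') -> last y p = last y p' ->
  reduced (y :: p) -> reduced (y :: p') -> flip (y :: p) (y :: p').
Proof.
move=> [_ sc] wp wp' El rp rp'.
suff h : path_homotopic (y :: p) (y :: p').
  exact: flip_trans (flip_sym (run_id rp)) (flip_trans (run_homotopic h) (run_id rp')).
have E : rev (y :: p') = last y p' :: rev (belast y p') by rewrite lastI rev_rcons.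
have := rev_homotopic wp'; have := walk_rev wp'.
have := last_rcons y (rev p') y; rewrite -rev_cons E.
move: (rev _) => t /= Et wt hb.
have {}hb := path_homotopic_ctx (belast y p) [::] hb.
rewrite !cats0 -{2}El cats1 -lastI in hb.
apply: Relation_Operators.rst_trans (Relation_Operators.rst_sym _ _ _ _ hb) _.
have ep : edge_path y (p ++ t) y.
  rewrite /edge_path last_cat El Et; split=> //; apply/walk_path.
  rewrite -cat_cons lastI cat_rcons El; apply: walk_cat => //.
  by rewrite -El -lastI.
have := path_homotopic_ctx [::] p' (sc y (p ++ t) ep).
rewrite /= -catA.
by have -> : y :: p ++ t ++ p' = belast y p ++ last y p' :: t ++ p'
  by rewrite -El -cat_cons lastI cat_rcons.
Qed.

End Steps.

(** * The path metric *)

Lemma leastP (P : set nat) n : P n -> P (least P) /\ (least P <= n)%N.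
Proof.
move=> Pn; have exP : exists m, `[< P m >] by exists n; apply/asboolP.
have [m /asboolP Pm mP] := ex_minnP exP.
have h : exists m, P m /\ forall k, P k -> (m <= k)%N.
  by exists m; split=> // k Pk; apply: mP; apply/asboolP.
rewrite /least; case: xgetP => [k -> [Pk kP]|nP]; first by split=> //; apply: kP.
by case: h => k /nP.
Qed.

Section Metric.
Variable X : cube_complex.

Lemma walk_catE (s : seq X) x s' :
  walk (s ++ x :: s') -> walk (rcons s x) /\ walk (x :: s').
Proof.
elim: s => [//|y [|z s] IH] /=.
  by move=> [xy h].
by move=> [yz /IH[h1 h2]].
Qed.

Hypothesis catX : CAT0 X.
Implicit Types (x y z w a b c d u m : X) (s l r q p : seq X).

Let flX : flag_links X := catX.2.
Let scX : simply_connected X := catX.1.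

Lemma dist_walk x y :
  exists p, [/\ walk (x :: p), last x p = y & size p = dist x y].
Proof.
have [p ep] := scX.1 x y.
have [] := @leastP [set n | exists2 p, edge_path x p y & size p = n] (size p).
  by exists p.
by move=> [q [/walk_path wq lq] sq] _; exists q.
Qed.

Lemma dist_le x p : walk (x :: p) -> (dist x (last x p) <= size p)%N.
Proof.
move=> /walk_path wp.
by have [] := @leastP [set n | exists2 q, edge_path x q (last x p) & size q = n] (size p);
  first by exists p.
Qed.

Lemma dist_triangle y x z : (dist x z <= dist x y + dist y z)%N.
Proof.
have [p [wp lp sp]] := dist_walk x y; have [q [wq lq sq]] := dist_walk y z.
have := @dist_le x (p ++ q); rewrite last_cat lp lq size_cat sp sq; apply.
rewrite -cat_cons lastI lp cat_rcons; apply: walk_cat => //.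
by rewrite -lp -lastI.
Qed.

Lemma dist_sym x y : dist x y = dist y x.
Proof.
suff h a b : (dist a b <= dist b a)%N by apply/eqP; rewrite eqn_leq !h.
have [p [wp lp sp]] := dist_walk b a.
have := walk_rev wp; rewrite lastI rev_rcons lp => /dist_le.
rewrite size_rev size_belast sp.
have -> // : last a (rev (belast b p)) = b.
by have := congr1 (last a) (rev_cons b p); rewrite lastI rev_rcons lp /= last_rcons.
Qed.

Lemma distxx x : dist x x = 0%N.
Proof. by apply/eqP; rewrite -leqn0; apply: (@dist_le x [::]). Qed.

Lemma dist_eq0 x y : dist x y = 0%N -> x = y.
Proof. by have [[|z p] [_ <- //]] := dist_walk x y; move=> <-. Qed.

Lemma backtracks_size s : backtracks s -> (2 < size s)%N.
Proof. by elim=> // x {}s _ /leqW. Qed.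

Lemma backtracks_shorten s : backtracks s -> walk s ->
  exists s', [/\ walk s', size s = (size s').+2, forall x, last x s' = last x s
    & forall x, head x s' = head x s].
Proof.
elim=> {s} [x y s [_ [_ h]]|x s bt IH ws]; first by exists (x :: s).
have [|s' [ws' ss' ls' hs']] := IH; first by case: ws.
case: s' => [|z s'] in ws' ss' ls' hs' *.
  by have := backtracks_size bt; rewrite ss'.
exists (x :: z :: s'); split=> //=; last by move=> _; have /= := ls' x.
  case: s bt ss' hs' {ls' IH} ws => // y s _ _ /(_ z) /= <- [xz _].
  by split.
by rewrite ss'.
Qed.

Lemma geodesic_reduced x p : walk (x :: p) -> size p = dist x (last x p) ->
  reduced (x :: p).
Proof.
move=> wp sp t h bt.
have [s [ws ss ls hs]] := backtracks_shorten bt (flip_walk h wp).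
have [t' Et] := flip_consE h.
case: s => [|y s] in ws ss ls hs *; first by have := backtracks_size bt; rewrite ss.
have Ey : y = x by have := hs x; rewrite Et.
rewrite Ey in ws ss ls.
have /= El := ls x; have := flip_last x h; rewrite /= -El => El'.
have := dist_le ws; rewrite -El' -sp; have := flip_size h; rewrite ss /=; lia.
Qed.

(** Geodesics are reduced, reduced walks with the same ends are flip equivalent, and flips preserve
    length. *)
Lemma reduced_dist x p : walk (x :: p) -> reduced (x :: p) ->
  size p = dist x (last x p).
Proof.
move=> wp rp; have [q [wq lq sq]] := dist_walk x (last x p).
have rq : reduced (x :: q) by apply: geodesic_reduced; rewrite // lq.
have := flip_size (reduced_walk_flip flX scX wp wq (esym lq) rp rq).
by rewrite -sq => -[].
Qed.

(** Prepend [x] to a geodesic from [y] to [u]: the result is reduced, hence geodesic, or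
    [reduced_consN] reroutes the geodesic through [x]. *)
Lemma dist_adj u x y : adjacent x y ->
  dist x u = (dist y u).+1 \/ dist y u = (dist x u).+1.
Proof.
move=> xy; have [p [wp lp sp]] := dist_walk y u.
have rp : reduced (y :: p) by apply: geodesic_reduced; rewrite // lp.
have wxp : walk (x :: y :: p) by split.
have [rxp|nrxp] := pselect (reduced (x :: y :: p)).
  by left; have := reduced_dist wxp rxp; rewrite /= lp => <-; rewrite sp.
have [q hq] := reduced_consN flX rp nrxp.
have rq := reduced_flip hq rp; have wq := flip_walk hq wp.
right; have := reduced_dist wq.2 (reduced_tl rq).
have /= := flip_last y hq; rewrite lp => <- <-.
by have := flip_size hq => /= -[<-].
Qed.

Lemma dist1 x y : adjacent x y -> dist x y = 1%N.
Proof.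
by move=> xy; case: (dist_adj y xy); rewrite distxx.
Qed.

(** Geodesics from [y] to [u] through [a] and through [b] are reduced, hence flip equivalent, and
    [flip_diamond] applies. *)
Lemma quadrangle u y a b : a <> b -> adjacent y a -> adjacent y b ->
  dist y u = (dist a u).+1 -> dist y u = (dist b u).+1 ->
  exists2 c, square y a c b & dist a u = (dist c u).+1.
Proof.
move=> nab ya yb da db.
have geo t : adjacent y t -> dist y u = (dist t u).+1 ->
    exists p, [/\ walk (y :: t :: p), last t p = u, size p = dist t u & reduced (y :: t :: p)].
  move=> yt dt; have [p [wp lp sp]] := dist_walk t u.
  exists p; split=> //; apply: geodesic_reduced => //=.
  by rewrite lp sp dt.
have [p [wp lp sp rp]] := geo a ya da; have [q [wq lq sq rq]] := geo b yb db.
have h := reduced_walk_flip flX scX wp wq (etrans lp (esym lq)) rp rq.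
have [c [r [sqr h1 _]]] := flip_diamond flX nab h.
exists c => //.
have r1 := reduced_flip h1 (reduced_tl rp); have w1 := flip_walk h1 wp.2.
have /= := flip_last a h1; rewrite lp => El.
have := reduced_dist w1.2 (reduced_tl r1); have := reduced_dist w1 r1.
by rewrite /= -El => <- <-.
Qed.

Lemma on_geodesicP x y m : on_geodesic x y m <-> (dist x m + dist m y = dist x y)%N.
Proof.
split.
  move=> [p [q [[[/walk_path w l] s] lm]]].
  have := dist_triangle m x y; rewrite -s size_cat.
  rewrite -cat_cons lastI lm cat_rcons in w.
  have [w1 w2] := walk_catE w.
  move: l; rewrite last_cat lm => l; have := dist_le w2; rewrite l.
  rewrite -lm -lastI in w1; have := dist_le w1; rewrite lm; lia.
have [p [wp lp sp]] := dist_walk x m; have [q [wq lq sq]] := dist_walk m y.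
move=> E; exists p, q; split=> //; split; last by rewrite size_cat sp sq.
split; last by rewrite last_cat lp.
apply/walk_path; rewrite -cat_cons lastI lp cat_rcons; apply: walk_cat => //.
by rewrite -lp -lastI.
Qed.

End Metric.

(** * Medians and convexity *)

Section Median.
Variable X : cube_complex.
Hypothesis catX : CAT0 X.
Implicit Types (x y z w a b c u m : X) (D : set X).

Let flX : flag_links X := catX.2.

Local Notation d := (@dist X).
Local Notation dist_adj := (dist_adj catX).
Local Notation dist_sym := (dist_sym catX).
Local Notation dist_triangle := (dist_triangle catX).

Lemma dist_adjr u x y : adjacent x y -> d u x = (d u y).+1 \/ d u y = (d u x).+1.
Proof. by move=> xy; rewrite !(dist_sym u); apply: dist_adj. Qed.

Lemma geodesic_step x y : (0 < d x y)%N -> exists2 z, adjacent x z & d x y = (d z y).+1.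
Proof.
move=> n0; have [p [wp lp sp]] := dist_walk catX x y.
case: p => [|z p] in wp lp sp *; first by rewrite -sp in n0.
exists z; first by case: wp.
have [xz wz] := wp; have := dist_le (wz : walk (z :: p)); move: lp => /= ->.
by case: (dist_adj y xz); move: sp => /=; lia.
Qed.

(** Induction on the distance from [y] to [z]: it suffices to find a neighbour of [y] closer to both
    [x] and [z]. *)
Lemma median_between x y z : exists m,
  [/\ d x m + d m y = d x y, d y m + d m z = d y z & d x m + d m z = d x z]%N.
Proof.
have [n] := ubnP (d y z); elim: n y => // n IH y le_n.
have [yz0|yz0] := posnP (d y z).
  by exists y; rewrite (dist_eq0 catX yz0) !distxx !addn0.
have rec c : adjacent y c -> d y z = (d c z).+1 -> d x y = (d x c).+1 ->
    exists m, [/\ d x m + d m y = d x y, d y m + d m z = d y z & d x m + d m z = d x z]%N.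
  move=> yc ec ex; have [|m [h1 h2 h3]] := IH c; first by lia.
  have := dist_triangle m x y; have := dist_triangle m y z.
  rewrite (dist_sym c m) in h2; rewrite (dist_sym y m).
  by exists m; rewrite (dist_sym y m); case: (dist_adjr m yc); split; lia.
have [y' yy' ey'] := geodesic_step yz0.
case: (dist_adjr x yy') => exy; first exact: rec yy' ey' exy.
(* The step to [y'] moves away from [x]. If the median [m] of [x], [y'], [z] is [y'], then [y] is
   already between [x] and [z]; otherwise the first step [y''] from [y'] to [m] approaches both, and
   the square on [y] and [y''] provides the neighbour. *)
have [|m [h1 h2 h3]] := IH y'; first by lia.
have [m0|m0] := posnP (d y' m).
  exists y; rewrite !distxx !addn0 add0n; split=> //.
  rewrite -(dist_eq0 catX m0) in h3.
  by have := dist_triangle y x z; lia.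
have [y'' y'y'' ey''] := geodesic_step m0.
have dx'' : d x y' = (d x y'').+1.
  case: (dist_adjr x y'y'') => //.
  have := dist_triangle m x y''; rewrite (dist_sym m y'').
  by move: h1; rewrite (dist_sym m y'); lia.
have dz'' : d y' z = (d y'' z).+1.
  case: (dist_adj z y'y'') => //.
  by have := dist_triangle m y'' z; lia.
have nyy : y <> y'' by move=> E; move: ey'; rewrite E; lia.
have [||c sq ec] := @quadrangle _ catX x y' y y'' nyy (adjacent_sym yy') y'y''.
- by rewrite !(dist_sym _ x).
- by rewrite !(dist_sym _ x).
apply: (rec c).
- by have [_ [_ h] _ _] := sq.
- have [_ _ [/adjacent_sym cy _] _] := square_rot (square_rot (square_flip sq)).
  have := dist_adj z (square_adj (square_rot (square_rot sq))).
  have := dist_adj z (square_adj (square_rot sq)).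
  by lia.
- by rewrite !(dist_sym x).
Qed.

Lemma is_median_ex x y z : exists m, is_median x y z m.
Proof.
have [m [h1 h2 h3]] := median_between x y z.
by exists m; split; apply/(on_geodesicP catX).
Qed.

Definition convex D : Prop :=
  forall x y p, D x -> D y -> (d x p + d p y)%N = d x y -> D p.

(* Take the median of [p] and of points of [D] near [x] and [y]. *)
Lemma convex_coarse D x y p n : convex D ->
  (exists2 x', D x' & (d x x' <= n)%N) -> (exists2 y', D y' & (d y y' <= n)%N) ->
  (d x p + d p y)%N = d x y -> exists2 p', D p' & (d p p' <= n.*2)%N.
Proof.
move=> cD [x' Dx' hx] [y' Dy' hy] hp.
have [m [h1 h2 h3]] := median_between p x' y'.
exists m; first exact: cD Dx' Dy' h2.
have := dist_triangle x p x'; have := dist_triangle y p y'.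
have := dist_triangle x' x y; have := dist_triangle y' x' y.
rewrite (dist_sym p x) (dist_sym y' y) (dist_sym x' m) in h2 *.
by lia.
Qed.

(** The hyperplanes of the two edges cross or are nested: a vertex [m] closer to both [q] and [p']
    than to [p] yields a square by [quadrangle]. *)
Lemma square_or_nested p' p q : adjacent p' p -> adjacent p q -> p' <> q ->
  (exists c, square p q c p') \/
  (forall m, d p m = (d q m).+1 -> d p' m = (d p m).+1).
Proof.
move=> pp' pq np'q; have [|h] := pselect (exists c, square p q c p'); first by left.
right=> m dq; case: (dist_adj m pp') => // dp; case: h.
have [c sq _] := @quadrangle _ catX m p q p' (nesym np'q) pq (adjacent_sym pp') dq dp.
by exists c.
Qed.

(** Opposite edges of a square cross the same hyperplane. Otherwise [quadrangle] at [p] gives a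
    second square on [q] and [p'] whose fourth corner, equal to [c], has the wrong distance to
    [m]. *)
Lemma square_parallel p q c p' m : square p q c p' ->
  d p m = (d q m).+1 -> d p' m = (d c m).+1.
Proof.
move=> sq dq; have [_ [pq qc] [cp' p'p] [_ nqp']] := sq.
case: (dist_adj m cp') => // dc.
have dp : d p m = (d p' m).+1.
  by case: (dist_adj m p'p); case: (dist_adj m qc); lia.
have [c' sq' ec'] := @quadrangle _ catX m p q p' nqp' pq (adjacent_sym p'p) dq dp.
have Ec : c' = c := square_uniq sq' sq.
by move: ec'; rewrite Ec; lia.
Qed.

(* Every hyperplane between [x] and [q] lies behind one adjacent to [x]. *)
Lemma nested_edge x p q : adjacent p q -> d x q = (d x p).+1 ->
  exists a, [/\ adjacent x a, d x q = (d a q).+1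
    & forall m, d p m = (d q m).+1 -> d x m = (d a m).+1].
Proof.
have [n] := ubnP (d x p); elim: n p q => // n IH p q le_n pq eq.
have [xp0|xp0] := posnP (d x p).
  have Ep := dist_eq0 catX xp0; exists q; rewrite Ep; split=> //.
  by rewrite distxx (dist1 catX pq).
have [|p' pp' ep'] := @geodesic_step p x; first by rewrite dist_sym.
rewrite !(dist_sym _ x) in ep'.
have np'q : p' <> q by move=> E; move: ep'; rewrite E; lia.
have [[c sq]|nest] := square_or_nested (adjacent_sym pp') pq np'q.
  have dc : d x c = (d x p').+1.
    have := dist_adjr x (square_adj (square_rot sq)).
    by have := dist_adjr x (square_adj (square_rot (square_rot sq))); lia.
  have [||a [xa ea ha]] := IH p' c _ _ dc; first by lia.
    exact: adjacent_sym (square_adj (square_rot (square_rot sq))).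
  exists a; split=> //; last by move=> m /(square_parallel sq)/ha.
  have := dist_triangle c a q; rewrite (dist1 catX (adjacent_sym (square_adj (square_rot sq)))).
  by case: (dist_adj q xa); lia.
have [|a [xa ea ha]] := IH p' p _ (adjacent_sym pp') ep'; first by lia.
exists a; split=> //; last by move=> m /nest/ha.
have := dist_triangle p a q; rewrite (dist1 catX pq).
by case: (dist_adj q xa); lia.
Qed.

(** * Minimizers of a sum of distances *)

Section Argmin.
Variables (T : finType) (t : T -> X).

Definition total_dist x : nat := (\sum_i d x (t i))%N.

Definition argmin D : set X :=
  [set x | D x /\ forall y, D y -> (total_dist x <= total_dist y)%N].

(** For the edge from [x] to [a] given by [nested_edge], every [t i] beyond the edge [pq] is beyond
    [xa]. So the sum grows from [p] to [q] at least as much as from [x] to [a], where it cannot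
    decrease. *)
Lemma total_dist_mono D x p q : convex D -> argmin D x -> D q -> adjacent p q ->
  d x q = (d x p).+1 -> (total_dist p <= total_dist q)%N.
Proof.
move=> cD [Dx hx] Dq pq eq; have [a [xa ea ha]] := nested_edge pq eq.
have Da : D a by apply: (cD _ _ _ Dx Dq); rewrite ea (dist1 catX xa).
have := hx _ Da.
suff : (total_dist p + total_dist a <= total_dist q + total_dist x)%N by lia.
rewrite /total_dist -!big_split /=; apply: leq_sum => i _.
have := ha (t i); have := dist_adj (t i) pq; have := dist_adj (t i) xa.
by lia.
Qed.

Lemma argmin_convex D : convex D -> convex (argmin D).
Proof.
move=> cD x y p hx hy hp; have [Dx mx] := hx; have [Dy my] := hy.
have Dp : D p by apply: cD hp.
split=> // z Dz; apply: leq_trans (my _ Dz).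
have [n] := ubnP (d p y); elim: n p hp Dp => // n IH p hp Dp le_n.
have [p0|p0] := posnP (d p y); first by rewrite (dist_eq0 catX p0).
have [q pq eq] := geodesic_step p0.
have := dist_triangle q x y; have := dist_adjr x pq => h1 h2.
have hq : (d x q + d q y)%N = d x y by lia.
have Dq : D q by apply: cD hq.
apply: leq_trans (IH q hq Dq _); last by lia.
by apply: (total_dist_mono cD hx) => //; lia.
Qed.

(** Nested hyperplanes would make the sum of distances strictly convex at [p], since [p] is itself
    some [t i]; but it takes the same value at the three minimizers. *)
Lemma argmin_square D p' p q : (forall x, D x -> exists i, t i = x) ->
  argmin D p' -> argmin D p -> argmin D q ->
  adjacent p' p -> adjacent p q -> p' <> q -> exists c, square p q c p'.
Proof.
move=> Dt [Dp' hp'] [Dp hp] [Dq hq] pp' pq npq.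
have [//|nest] := square_or_nested pp' pq npq.
have := hp _ Dp'; have := hp' _ Dp; have := hp _ Dq; have := hq _ Dp.
suff : (total_dist p + total_dist p < total_dist q + total_dist p')%N by lia.
have [i ti] := Dt _ Dp.
rewrite /total_dist -!big_split /= (bigD1 i) //= [X in (_ < X)%N](bigD1 i) //=.
rewrite ti distxx (dist1 catX pp') (dist_sym q) (dist1 catX pq).
rewrite -addSn; apply: leq_add => //; apply: leq_sum => j _.
have := nest (t j); have := dist_adj (t j) pp'; have := dist_adj (t j) pq.
by lia.
Qed.

End Argmin.

(** The edges of [D] at [x] pairwise span squares, so flagness puts them into one cube [Q]. A
    farther [y] is the last corner of a square whose other corners lie in [D] closer to [x], so
    [square_sub] applies by induction. *)
Lemma convex_in_cube D x : convex D -> D x ->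
  finite_set [set a | D a /\ adjacent x a] ->
  (forall p' p q, D p' -> D p -> D q -> adjacent p' p -> adjacent p q -> p' <> q ->
     exists c, square p q c p') ->
  exists2 Q, cube Q & D `<=` Q.
Proof.
move=> cD Dx fA sqD.
have [|y z [Dy xy] [Dz xz] nyz|Q [cQ Qx QE]] := @flX x _ fA; first by move=> y [].
  have [c sq] := sqD _ _ _ Dy Dx Dz (adjacent_sym xy) xz nyz.
  by rewrite setUC; apply: square_link sq.
exists Q => // y; have [n] := ubnP (d x y); elim: n y => // n IH y le_n Dy.
have [xy0|xy0] := posnP (d y x); first by rewrite (dist_eq0 catX xy0).
have [p yp ep] := geodesic_step xy0.
have Dp : D p by apply: (cD _ _ _ Dy Dx); rewrite ep (dist1 catX yp).
have [px0|px0] := posnP (d p x).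
  have : [set a | D a /\ adjacent x a] y.
    by split=> //; apply: adjacent_sym; rewrite -(dist_eq0 catX px0).
  by rewrite QE => -[].
have [q pq eq] := geodesic_step px0.
have Dq : D q by apply: (cD _ _ _ Dp Dx); rewrite eq (dist1 catX pq).
have nqy : q <> y by move=> E; move: ep; rewrite -E; lia.
have [c sq] := sqD _ _ _ Dq Dp Dy (adjacent_sym pq) (adjacent_sym yp) nqy.
have yc := square_adj (square_rot sq); have cq := square_adj (square_rot (square_rot sq)).
rewrite !(dist_sym _ x) in ep eq.
have dc : d x c = d x p.
  by have := dist_adjr x yc; have := dist_adjr x cq; lia.
have dqy : d q y = 2%N.
  have := dist_triangle q x y; have := dist_triangle p q y.
  by rewrite (dist1 catX (adjacent_sym pq)) (dist1 catX (adjacent_sym yp)); lia.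
have Dc : D c.
  apply: (cD _ _ _ Dq Dy).
  by rewrite dqy (dist1 catX (adjacent_sym cq)) (dist1 catX (adjacent_sym yc)).
apply: (square_sub cQ (square_rot (square_rot (square_rot sq)))); apply: IH => //; lia.
Qed.

End Median.

(** * Cubical actions and fixed points *)

Lemma finite_set_bound (T : Type) (A : set T) (f : T -> nat) :
  finite_set A -> exists n, forall x, A x -> (f x <= n)%N.
Proof.
move=> /(finite_image f)/finite_seqP[s Es]; exists (\max_(i <- s) i)%N => x Ax.
have : [set` s] (f x) by rewrite -Es; exists x.
by move=> /= fs; apply: leq_bigmax_seq.
Qed.

Lemma cube_finite (X : cube_complex) (C : set X) : cube C -> finite_set C.
Proof. by move=> /cube_chart[n [c [_ -> _]]]; apply/finite_image/finite_finset. Qed.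

Lemma cube_sub (X : cube_complex) (C C' : set X) x : cube C -> cube C' -> C x -> C' x ->
  (forall y, C y -> adjacent x y -> C' y) -> C `<=` C'.
Proof.
move=> cC cC' Cx C'x nb.
have [E|cI] := cube_meet cC cC'; first by have : (C `&` C') x by []; rewrite E.
have [n [c ch]] := cube_chart cC; have [injc _ faceP] := ch.
have /faceP[|f Ef] := cI; first by move=> ? [].
have [e xe] := chart_ex ch Cx.
have inf e' : C' (c e') -> face f e'.
  move=> h; have : (C `&` C') (c e') by split=> //; apply: chart_in ch _.
  by rewrite Ef => -[e1 fe1 /injc <-].
have f0 i : f i = None.
  case fi : (f i) => [b|//].
  have := inf e; rewrite -xe => /(_ C'x _ _ fi).
  have := inf (toggle e i) (nb _ (chart_in ch _) _) _ _ fi; rewrite ffunE eqxx xe.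
  by move/(_ (chart_adj ch e i)) => <-; case: (e i).
move=> y /(chart_ex ch)[e' ->].
have : [set c x | x in face f] (c e') by exists e' => // i b; rewrite f0.
by rewrite -Ef => -[].
Qed.

Lemma minimal_cube (X : cube_complex) (D Q : set X) : D !=set0 -> cube Q -> D `<=` Q ->
  exists Q0, [/\ cube Q0, D `<=` Q0 & forall Q', cube Q' -> D `<=` Q' -> Q0 `<=` Q'].
Proof.
move=> [x Dx] cQ; have [n [c ch]] := cube_chart cQ.
have : Q `<=` Q by [].
move: {1 2 4}Q cQ => Q1; have [m] := ubnP #|[set e | `[< Q1 (c e) >] ]%SET|.
elim: m Q1 => // m IH Q1 le_m cQ1 Q1Q DQ1.
have [h|/existsNP[Q2 /not_implyP[cQ2 /not_implyP[DQ2 nQ]]]] :=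
  pselect (forall Q', cube Q' -> D `<=` Q' -> Q1 `<=` Q'); first by exists Q1.
have [E|cI] := cube_meet cQ1 cQ2.
  by have : (Q1 `&` Q2) x by [split; [apply: DQ1|apply: DQ2]]; rewrite E.
apply: (IH (Q1 `&` Q2)) => //.
- rewrite ltnS in le_m; apply: leq_trans le_m; apply: proper_card; apply/properP; split.
    by apply/fintype.subsetP => e; rewrite !finset.inE => /asboolP[h _]; apply/asboolP.
  have /existsNP[y /not_implyP[Q1y Q2y]] := nQ.
  have [e ye] := chart_ex ch (Q1Q _ Q1y).
  exists e; rewrite !finset.inE -?ye; first exact/asboolP.
  by apply/asboolPn => -[].
- by move=> y [/Q1Q].
- by move=> y Dy; split; [apply: DQ1|apply: DQ2].
Qed.

Local Open Scope group_scope.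

Section Action.
Variables (G : groupType) (X : cube_complex) (a : cubical_action G X).
Implicit Types (g h : G) (x y z p : X).

Lemma actK g : cancel (a g) (a g^-1).
Proof. by move=> x; rewrite -Defs.actM mulVg Defs.act1. Qed.

Lemma actKV g : cancel (a g^-1) (a g).
Proof. by move=> x; rewrite -Defs.actM mulgV Defs.act1. Qed.

Lemma act_adj g x y : adjacent x y -> adjacent (a g x) (a g y).
Proof.
move=> [nxy Cxy]; split; first by move/(can_inj (actK g)).
by have := act_cube a g Cxy; rewrite image_setU !image_set1.
Qed.

Lemma act_walk g (s : seq X) : walk s -> walk [seq a g x | x <- s].
Proof.
elim: s => // x [|y s] IH //= [xy h]; split; first exact: act_adj.
exact: IH.
Qed.

Hypothesis catX : CAT0 X.

Lemma act_dist g x y : dist (a g x) (a g y) = dist x y.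
Proof.
suff h k u v : (dist (a k u) (a k v) <= dist u v)%N.
  by apply/eqP; rewrite eqn_leq h /= -{1}(actK g x) -{1}(actK g y) h.
have [p [wp lp <-]] := dist_walk catX u v.
have := dist_le (act_walk k wp : walk (a k u :: [seq a k x | x <- p])).
by rewrite last_map size_map lp.
Qed.

Lemma act_distV g x y : dist (a g x) y = dist x (a g^-1 y).
Proof. by rewrite -{1}(actKV g y) act_dist. Qed.

Section Finite.
Hypotheses (pr : proper_action a) (cc : cocompact_action a).

Lemma finite_transporter x y : finite_set [set g | a g x = y].
Proof.
have /pr : finite_set [set x; y] by rewrite finite_setU; split; apply: finite_set1.
by apply: sub_finite_set => g /= <-; exists x; [left|right].
Qed.

(** Each edge at [x] is a translate of one of finitely many cubes, and properness allows finitely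
    many translations taking a given vertex to [x]. *)
Lemma finite_neighbours x : finite_set [set y | adjacent x y].
Proof.
have [K [fK Kc KP]] := cc.
apply: (@sub_finite_set _ _ (\bigcup_(D in K) \bigcup_(d in D)
  \bigcup_(g in [set g | a g d = x]) (a g @` D))); last first.
  apply: bigcup_finite => // D KD; apply: bigcup_finite; first exact: cube_finite (Kc _ KD).
  move=> d Dd; apply: bigcup_finite; first exact: finite_transporter.
  by move=> g _; apply/finite_image/cube_finite/Kc.
move=> y [_ /KP[g [D KD E]]].
have : [set x; y] x by left.
rewrite E => -[d Dd dx].
exists D => //; exists d => //; exists g => //.
by rewrite -E; right.
Qed.

Lemma finite_ball x n : finite_set [set y | (dist x y <= n)%N].
Proof.
elim: n => [|n IH].
  apply: (@sub_finite_set _ _ [set x]); last exact: finite_set1.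
  by move=> y; rewrite /= leqn0 => /eqP /(dist_eq0 catX).
apply: (@sub_finite_set _ _ ([set x] `|` \bigcup_(z in [set y | (dist x y <= n)%N])
  [set y | adjacent z y])); last first.
  rewrite finite_setU; split; first exact: finite_set1.
  by apply: bigcup_finite => // z _; apply: finite_neighbours.
move=> y /= le_y; have [yx0|yx0] := posnP (dist y x).
  by left; rewrite (dist_eq0 catX yx0).
right; have [z yz ez] := geodesic_step catX yx0.
exists z; last exact: adjacent_sym.
by rewrite /= (dist_sym catX); move: le_y; rewrite (dist_sym catX) ez.
Qed.

Lemma cobounded x0 : exists n, forall p, exists g, (dist p (a g x0) <= n)%N.
Proof.
have [K [fK Kc KP]] := cc.
have [|n hn] := @finite_set_bound _ (\bigcup_(D in K) D) (fun d => dist d x0).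
  by apply: bigcup_finite => // D /Kc; apply: cube_finite.
exists n => p; have [g [D KD E]] := KP _ (cube_vertex p).
have : [set p] p by [].
rewrite E => -[d Dd <-]; exists g; rewrite act_dist.
by apply: hn; exists D.
Qed.

End Finite.

Definition fixed_by (K : finGroupType) (phi : K -> G) : set X :=
  [set x | forall k, a (phi k) x = x].

Hypothesis sc : strongly_cellular a.

(** * Fixed points of a finite group *)

Section FixedPoints.
Variables (K : finGroupType) (phi : K -> G).
Hypothesis phiM : {morph phi : h k / h * k >-> h * k}.

Lemma morph1 : phi 1 = 1.
Proof. by apply: (mulgI (phi 1)); rewrite -phiM !mulg1. Qed.

Lemma morphV k : phi k^-1 = (phi k)^-1.
Proof. by apply: (mulgI (phi k)); rewrite -phiM !mulgV morph1. Qed.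

(* The translates of a neighbour of [x] on a geodesic to [y] span a cube,
   which is fixed pointwise by strong cellularity. *)
Lemma fixed_by_step x y b : fixed_by phi x -> fixed_by phi y -> adjacent x b ->
  dist x y = (dist b y).+1 -> fixed_by phi b.
Proof.
move=> fx fy xb eb.
pose A := range (fun k => a (phi k) b).
have Aadj z : A z -> adjacent x z.
  by move=> [k _ <-]; rewrite -(fx k); apply: act_adj.
have Adist z : A z -> dist x y = (dist z y).+1.
  by move=> [k _ <-]; rewrite -{2}(fy k) act_dist.
have [|y1 y2 A1 A2 n12|C [cC Cx AE]] := @catX.2 x A _ Aadj.
- exact/finite_image/finite_finset.
- have [c sq _] := quadrangle catX n12 (Aadj _ A1) (Aadj _ A2) (Adist _ A1) (Adist _ A2).
  exact: square_link sq.
have Ak k z : A z -> A (a (phi k) z).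
  by move=> [h _ <-]; exists (k * h) => //; rewrite phiM Defs.actM.
have CA z : C z -> adjacent x z -> A z by move=> Cz xz; rewrite AE.
have AC z : A z -> C z by rewrite AE => -[].
have sub k : C `<=` a (phi k) @` C.
  apply: (cube_sub cC (act_cube a _ cC) Cx); first by exists x.
  move=> z Cz xz; exists (a (phi k^-1) z); first by apply/AC/Ak/CA.
  by rewrite morphV actKV.
move=> k; apply: (sc cC); last by apply/AC; exists 1 => //; rewrite morph1 Defs.act1.
apply/seteqP; split; last exact: sub.
move=> _ [z /(sub k^-1)[z' Cz' <-] <-].
by rewrite morphV actKV.
Qed.

Lemma fixed_by_convex : convex (fixed_by phi).
Proof.
move=> x y p; have [n] := ubnP (dist x p); elim: n x => // n IH x le_n fx fy hp.
have [xp0|xp0] := posnP (dist x p); first by rewrite -(dist_eq0 catX xp0).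
have [b xb eb] := geodesic_step catX xp0.
have eby : dist x y = (dist b y).+1.
  by case: (dist_adj catX y xb) => //; have := dist_triangle catX p b y; lia.
by apply: (IH b) => //; [lia|apply: fixed_by_step fx fy xb eby|lia].
Qed.

Lemma total_dist_act n (e : 'I_n -> X) k x :
  total_dist (fun i : K * 'I_n => a (phi i.1) (e i.2)) (a (phi k) x) =
  total_dist (fun i : K * 'I_n => a (phi i.1) (e i.2)) x.
Proof.
rewrite /total_dist -!(pair_big xpredT xpredT (fun (h : K) (i : 'I_n) => dist _ (a (phi h) (e i)))) /=.
rewrite (reindex_inj (mulgI k)) /=; apply: eq_bigr => h _; apply: eq_bigr => i _.
by rewrite phiM Defs.actM act_dist.
Qed.

Lemma argmin_ex (T : finType) (t : T -> X) (D : set X) : D !=set0 -> argmin t D !=set0.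
Proof.
move=> [x Dx]; have [n] := ubnP (total_dist t x); elim: n x Dx => // n IH x Dx le_n.
have [h|/existsNP[y /not_implyP[Dy /negP]]] :=
  pselect (forall y, D y -> (total_dist t x <= total_dist t y)%N); first by exists x.
by rewrite -ltnNge => lt; apply: (IH y) => //; lia.
Qed.

Definition invariant_by (D : set X) : Prop := forall k x, D x -> D (a (phi k) x).

Lemma argmin_invariant n (e : 'I_n -> X) D : invariant_by D ->
  invariant_by (argmin (fun i : K * 'I_n => a (phi i.1) (e i.2)) D).
Proof. by move=> iD k x [Dx hx]; split; [apply: iD|move=> y /hx; rewrite total_dist_act]. Qed.

(* Minimizing twice the sum of the distances to an invariant finite set yields
   an invariant convex set without nested hyperplanes, hence an invariant cube. *)
Lemma fixed_by_nonempty : proper_action a -> cocompact_action a ->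
  forall x0 : X, fixed_by phi !=set0.
Proof.
move=> pr cc x0.
pose t1 (i : K * 'I_1) := a (phi i.1) x0.
pose D1 := argmin t1 setT.
have cD1 : convex D1 by apply: argmin_convex.
have iD1 : invariant_by D1 by apply: (@argmin_invariant 1 (fun=> x0)).
(* One of the summands is the distance to [x0], so [D1] lies in a ball around [x0]. *)
have fD1 : finite_set D1.
  apply: sub_finite_set (finite_ball pr cc x0 (total_dist t1 x0)) => x [_ /(_ x0 I)].
  apply: leq_trans; rewrite /total_dist /t1 (bigD1 (1, ord0)) //= morph1 Defs.act1.
  by rewrite (dist_sym catX) leq_addr.
have [n [e he]] : exists n (e : 'I_n -> X), forall x, D1 x -> exists i, e i = x.
  have /finite_seqP[s Es] := fD1 : finite_set (D1 : set {classic X}).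
  exists (size s), (fun i => nth x0 s i) => x D1x.
  have : [set` s] x by rewrite -Es.
  move=> /= xs; have xs' : (index (x : {classic X}) s < size s)%N by rewrite index_mem.
  by exists (Ordinal xs'); apply: (@nth_index {classic X} x0 x s).
(* This family runs through every point of [D1], as [argmin_square] requires. *)
pose t2 (i : K * 'I_n) := a (phi i.1) (e i.2).
pose D2 := argmin t2 D1.
have cD2 : convex D2 by apply: argmin_convex.
have iD2 : invariant_by D2 by apply: argmin_invariant.
have [x D2x] : D2 !=set0 by apply/argmin_ex/argmin_ex; exists x0.
have [|p' p q hp' hp hq pp' pq npq|Q cQ DQ] := convex_in_cube catX cD2 D2x.
- by apply: sub_finite_set fD1 => y [[]].
- apply: (argmin_square catX _ hp' hp hq) => // y /he[i <-].
  by exists (1, i); rewrite /t2 /= morph1 Defs.act1.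
have [|Q0 [cQ0 DQ0 minQ]] := minimal_cube _ cQ DQ; first by exists x.
(* The translates of [Q0] are cubes that contain the invariant set [D2]. *)
have sub k : Q0 `<=` a (phi k) @` Q0.
  apply: minQ; first exact: act_cube.
  move=> y /(iD2 k^-1)/DQ0 h; eexists; first exact: h.
  by rewrite morphV actKV.
exists x => k; apply: (sc cQ0); last exact: DQ0.
apply/seteqP; split; last exact: sub.
move=> _ [z /(sub k^-1)[z' Cz' <-] <-].
by rewrite morphV actKV.
Qed.

End FixedPoints.
End Action.

(** * Words and cocycles on graph products *)

Section GraphProduct.
Variables (I : finType) (e : rel I) (F : I -> finGroupType).

Local Notation G := (graph_product e F).
Local Notation letter := {i : I & F i}.
Local Notation N := (normal_closure (edge_commutators e F)).
Implicit Types (g h t x y z : G) (u w : seq letter) (l : letter) (i j v : I).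

Definition ev w : G := qg_pi N (fp_pi w).

Definition word_of g : seq letter := fp_repr (qg_repr g).

Lemma word_ofK g : ev (word_of g) = g.
Proof. by rewrite /ev fp_reprK qg_reprK. Qed.

Lemma ev_cat u w : ev (u ++ w) = ev u * ev w.
Proof. by rewrite /ev -fp_mul_pi -qg_mul_pi. Qed.

Lemma ev_nil : ev [::] = 1. Proof. by []. Qed.

Lemma ev_cons l w : ev (l :: w) = ev [:: l] * ev w.
Proof. by rewrite -ev_cat. Qed.

Lemma ev_inv w : ev (word_inv w) = (ev w)^-1.
Proof. by rewrite /ev -fp_inv_pi -qg_inv_pi. Qed.

Definition inc v (a : F v) : G := ev [:: lett a].

Lemma ev_equiv u w : word_equiv u w -> ev u = ev w.
Proof. by move=> /fp_piP; rewrite /ev => ->. Qed.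

Lemma incM v : {morph @inc v : a b / a * b >-> a * b}.
Proof.
move=> a b; rewrite /inc -ev_cat; apply/esym/ev_equiv.
by apply: Relation_Operators.rst_step; apply: (@word_stepM _ _ [::] [::]).
Qed.

Lemma inc1 v : inc (1 : F v) = 1.
Proof.
apply: ev_equiv; apply: Relation_Operators.rst_step.
exact: (@word_step1 _ _ [::] [::]).
Qed.

Lemma commg_eq (P : groupType) (x y : P) : [~ x, y] = (y * x)^-1 * (x * y).
Proof. by rewrite /commg /conjg invMg !mulgA. Qed.

Lemma inc_comm i j (a : F i) (b : F j) : e i j -> inc a * inc b = inc b * inc a.
Proof.
move=> eij; rewrite /inc -!ev_cat; apply/esym; apply/qg_piP.
rewrite -!fp_mul_pi -[(_)^-1 * _]commg_eq.
by move=> M [_]; apply; exists i, j, a, b.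
Qed.

Section Cocycle.
Variables (Q : groupType) (c : G -> letter -> Q).
Hypothesis c1 : forall g i, c g (lett (1 : F i)) = 1.
Hypothesis cM : forall g i (a b : F i),
  c g (lett a) * c (g * inc a) (lett b) = c g (lett (a * b)).
Hypothesis cC : forall g i j (a : F i) (b : F j), e i j ->
  c g (lett a) * c (g * inc a) (lett b) = c g (lett b) * c (g * inc b) (lett a).

Fixpoint cochain g w : Q :=
  if w is l :: w' then c g l * cochain (g * ev [:: l]) w' else 1.

Lemma cochain_cat g u w : cochain g (u ++ w) = cochain g u * cochain (g * ev u) w.
Proof.
elim: u g => [|l u IH] g /=; first by rewrite ev_nil mul1g mulg1.
by rewrite IH [ev (l :: u)]ev_cons !mulgA.
Qed.

Lemma cochain_equiv g u w : word_equiv u w -> cochain g u = cochain g w.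
Proof.
elim=> {u w} //.
- move=> u w [{}u {}w i|{}u {}w i a b]; rewrite !cochain_cat /=.
    by rewrite c1 mul1g -[ev [:: _]]/(inc 1) inc1 mulg1.
  by rewrite -cM -![ev [:: _]]/(inc _) incM !mulgA.
- by move=> u v w _ -> _ ->.
Qed.

Definition fp_cochain g (x : free_product F) : Q := cochain g (fp_repr x).

Lemma fp_cochain_pi g w : fp_cochain g (fp_pi w) = cochain g w.
Proof. exact/cochain_equiv/fp_pi_repr. Qed.

Lemma fp_cochainM g (x y : free_product F) :
  fp_cochain g (x * y) = fp_cochain g x * fp_cochain (g * qg_pi N x) y.
Proof.
rewrite -(fp_reprK x) -(fp_reprK y) [fp_pi _ * fp_pi _]fp_mul_pi !fp_cochain_pi.
by rewrite cochain_cat.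
Qed.

Lemma fp_cochain1 g : fp_cochain g 1 = 1.
Proof. by rewrite [1]/(fp_pi [::]) fp_cochain_pi. Qed.

Lemma qg_pi1 : qg_pi N 1 = 1. Proof. by []. Qed.

Lemma qg_piM (x y : free_product F) : qg_pi N (x * y) = qg_pi N x * qg_pi N y.
Proof. by rewrite -qg_mul_pi. Qed.

Lemma qg_piV (x : free_product F) : qg_pi N x^-1 = (qg_pi N x)^-1.
Proof. by rewrite -qg_inv_pi. Qed.

Lemma fp_cochainV g (x : free_product F) : fp_cochain g x^-1 = (fp_cochain (g * qg_pi N x^-1) x)^-1.
Proof.
by apply: (mulIg (fp_cochain (g * qg_pi N x^-1) x)); rewrite -fp_cochainM !mulVg fp_cochain1.
Qed.

(** The elements with both properties form a normal subgroup containing the edge commutators. The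
    first property ensures that reading [x] returns to the base point, which products and conjugates
    need. *)
Lemma normal_closure_cochain (x : free_product F) : N x ->
  qg_pi N x = 1 /\ forall g, fp_cochain g x = 1.
Proof.
move=> /(_ [set y | qg_pi N y = 1 /\ forall g, fp_cochain g y = 1]).
apply; split; last first.
  move=> _ [i [j [a [b [eij ->]]]]]; split.
    by rewrite -qg_pi1; apply/esym/qg_piP; rewrite invg1 mul1g => M [_]; apply; exists i, j, a, b.
  move=> g; rewrite commg_eq fp_cochainM.
  have -> h : fp_cochain h (fp_inj a * fp_inj b) = fp_cochain h (fp_inj b * fp_inj a).
    by rewrite !fp_cochainM !fp_cochain_pi /= !mulg1; apply: cC.
  by rewrite -fp_cochainM mulVg fp_cochain1.
split=> /=.
- by split=> // g; rewrite fp_cochain1.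
- move=> y z [y1 cy] [z1 cz]; split; first by rewrite qg_piM y1 z1 mulg1.
  by move=> g; rewrite fp_cochainM cy cz mulg1.
- move=> y [y1 cy]; split; first by rewrite qg_piV y1 invg1.
  by move=> g; rewrite fp_cochainV cy invg1.
- move=> y z [y1 cy]; rewrite /conjg; split.
    by rewrite !qg_piM y1 mul1g -qg_piM mulVg.
  move=> g; rewrite !fp_cochainM cy mul1g y1 mulg1 -fp_cochainM mulVg.
  exact: fp_cochain1.
Qed.

Lemma cochain_ev g u w : ev u = ev w -> cochain g u = cochain g w.
Proof.
move=> /qg_piP/normal_closure_cochain[_ /(_ (g * ev u)) E].
rewrite -!fp_cochain_pi -(mulKVg (fp_pi u) (fp_pi w)) fp_cochainM.
by rewrite E mulg1.
Qed.

End Cocycle.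
End GraphProduct.

(** * Walls of a graph product *)

Lemma count_split (T : Type) (p : pred T) n (s : seq T) : (n < count p s)%N ->
  exists s1 x s2, [/\ s = s1 ++ x :: s2, p x & count p s1 = n].
Proof.
elim: s n => // x s IH n /=; case px : (p x) => /=; last first.
  rewrite add0n => /IH[s1 [y [s2 [-> py cn]]]].
  by exists (x :: s1), y, s2; split=> //=; rewrite px.
case: n => [|n]; first by exists [::], x, s.
rewrite add1n ltnS => /IH[s1 [y [s2 [-> py cn]]]].
by exists (x :: s1), y, s2; split=> //=; rewrite px cn.
Qed.

Lemma pairwise_count1 (T : eqType) (r : rel T) (p : pred T) (s : seq T) :
  pairwise r s -> (forall x y, p x -> p y -> ~~ r x y) -> (count p s <= 1)%N.
Proof.
move=> pw nr; elim: s pw => //= x s IH /andP[/allP rx /IH h].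
case px : (p x) => //=; rewrite add1n ltnS leqn0 eqn0Ngt -has_count.
by apply/hasPn => y /rx rxy; apply/negP => py; move: (nr _ _ px py); rewrite rxy.
Qed.

Section Walls.
Variables (I : finType) (e : rel I) (F : I -> finGroupType).
Hypothesis He : simplicial_graph e.

Local Notation G := (graph_product e F).
Local Notation letter := {i : I & F i}.
Local Notation ev := (@ev I e F).
Local Notation inc := (@inc I e F).
Implicit Types (g h t x y z : G) (u w : seq letter) (l : letter) (i j : I).

Definition minimal w : Prop := forall w', ev w' = ev w -> (size w <= size w')%N.

Lemma minimal_sub u1 u u2 : minimal (u1 ++ u ++ u2) -> minimal u.
Proof.
move=> m u' E; have := m (u1 ++ u' ++ u2); rewrite !ev_cat E !size_cat.
by move=> /(_ erefl); lia.
Qed.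

Lemma minimal_letter l : minimal [:: l] -> ev [:: l] <> 1.
Proof. by move=> m E; have := m [::] (esym E). Qed.

Lemma minimal_ex g : exists2 w, ev w = g & minimal w.
Proof.
have [n] := ubnP (size (word_of g)); move: (word_ofK g).
elim: n (word_of g) => // n IH w Ew le_n.
have [h|/existsNP[w' /not_implyP[Ew' /negP]]] := pselect (minimal w); first by exists w.
by rewrite -ltnNge => lt; apply: (IH w'); [rewrite Ew'|lia].
Qed.

Variable v : I.

Definition star : pred letter := fun l => (tag l == v) || e v (tag l).
Definition link : pred letter := fun l => e v (tag l).
Definition at_v : pred letter := fun l => tag l == v.

(* Its left cosets are the walls of type [v]. *)
Definition star_group : set G := [set g | exists2 w, all star w & ev w = g].

Lemma star_groupM g h : star_group g -> star_group h -> star_group (g * h).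
Proof.
move=> [u au <-] [w aw <-]; exists (u ++ w); first by rewrite all_cat au.
by rewrite ev_cat.
Qed.

Lemma star_group1 : star_group 1.
Proof. by exists [::]. Qed.

Lemma star_groupV g : star_group g -> star_group g^-1.
Proof.
move=> [w aw <-]; exists (word_inv w); last by rewrite ev_inv.
by rewrite /word_inv all_rev all_map; apply: sub_all aw => -[].
Qed.

Lemma star_groupMl g h : star_group h -> star_group (h * g) <-> star_group g.
Proof.
move=> hh; split=> [|hg]; last exact: star_groupM.
by move=> /(star_groupM (star_groupV hh)); rewrite mulKg.
Qed.

Lemma star_groupMr g h : star_group h -> star_group (g * h) <-> star_group g.
Proof.
move=> hh; split=> [h1|hg]; last exact: star_groupM.
by rewrite -(mulgK h g); apply: star_groupM => //; apply: star_groupV.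
Qed.

Lemma star_group_letter l : star l -> star_group (ev [:: l]).
Proof. by move=> sl; exists [:: l] => //=; rewrite sl. Qed.

Lemma at_v_star l : at_v l -> star l.
Proof. by rewrite /star /at_v /= => ->. Qed.

Lemma at_vP l : at_v l -> exists a : F v, l = lett a.
Proof. by case: l => i a /eqP /= E; move: a; rewrite E => a; exists a. Qed.

Lemma inc_link (a : F v) w : all link w -> ev w * inc a = inc a * ev w.
Proof.
elim: w => [|[i b] w IH] /=; first by rewrite ev_nil mul1g mulg1.
move=> /andP[evi /IH E]; rewrite ev_cons -mulgA E !mulgA; congr (_ * _).
by apply/esym/inc_comm.
Qed.

Lemma star_word w : all star w ->
  exists (a : F v) u, [/\ all link u, ev w = inc a * ev u & (size u <= size w)%N].
Proof.
elim: w => [|l w IH] /=; first by exists 1, [::]; rewrite inc1 mul1g.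
move=> /andP[sl /IH[a [u [lu E su]]]]; case/orP: sl => hl.
  have [b ->] := at_vP hl; exists (b * a), u; split=> //; last exact: leqW.
  by rewrite ev_cons E incM mulgA.
exists a, (l :: u); split=> //=; first by rewrite lu andbT.
rewrite ev_cons E mulgA [ev (l :: u)]ev_cons mulgA; congr (_ * _).
by apply: inc_link; rewrite /= /link hl.
Qed.

(* Deleting the letters outside the star is a retraction. *)
Lemma star_group_word w : star_group (ev w) ->
  exists (a : F v) u, [/\ all link u, ev w = inc a * ev u & (size u <= size w)%N].
Proof.
move=> [w' aw' E].
pose c (_ : G) l := if star l then ev [:: l] else 1.
have cE g u : cochain c g u = ev (seq.filter star u).
  by elim: u g => // l u IH g /=; rewrite IH /c; case: ifP => _; rewrite ?mul1g // -ev_cons.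
have Ew : ev w = ev (seq.filter star w).
  rewrite -E -{1}(all_filterP aw') -!(cE 1); apply: cochain_ev E.
  - by move=> g i; rewrite /c; case: ifP => // _; apply: inc1.
  - by move=> g i a b; rewrite /c /star /=; case: ifP => _; rewrite ?mulg1 // -incM.
  - move=> g i j a b eij; rewrite /c /star /=.
    by case: ifP; case: ifP => _ _; rewrite ?mul1g ?mulg1 //; apply: inc_comm.
have [a [u [lu Eu su]]] := star_word (filter_all star w).
exists a, u; split=> //; first by rewrite Ew.
by apply: leq_trans su _; rewrite size_filter count_size.
Qed.

(** Otherwise [u] equals an element of [F v] times a link word no longer than [u]; [l2] commutes
    past the link word and merges with that element and [l1], which shortens the word. *)
Lemma minimal_no_return l1 u l2 : at_v l1 -> at_v l2 -> minimal (l1 :: u ++ [:: l2]) ->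
  ~ star_group (ev u).
Proof.
move=> /at_vP[b1 ->] /at_vP[b2 ->] m /star_group_word[a [w [lw E sw]]].
have := m (lett (b1 * a * b2) :: w); rewrite ev_cons [RHS]ev_cons ev_cat E.
rewrite -!/(inc _) !incM -!mulgA (inc_link b2 lw) => /(_ erefl).
by rewrite /= size_cat /=; lia.
Qed.

Definition wall_letter g l : G := if at_v l && `[< star_group g >] then ev [:: l] else 1.

(* The product of the letters by which the path spelled [w] from [g]
   crosses the wall [star_group]. *)
Definition wall_crossing g w : G := cochain wall_letter g w.

Lemma wall_letter1 g i : wall_letter g (lett (1 : F i)) = 1.
Proof. by rewrite /wall_letter; case: ifP => // _; apply: inc1. Qed.

(** The cocycle conditions hold because letters of the star do not change membership in
    [star_group], and because of two adjacent vertices at most one is [v], the other then being in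
    its link. *)
Lemma wall_crossing_ev g u w : ev u = ev w -> wall_crossing g u = wall_crossing g w.
Proof.
have [symE irrE] := He.
have inH i (a : F i) h : star (lett a) -> `[< star_group (h * inc a) >] = `[< star_group h >].
  by move=> sa; apply/asbool_equiv_eq/star_groupMr/star_group_letter.
apply: cochain_ev.
- exact: wall_letter1.
- move=> h i a b; rewrite /wall_letter /at_v /=.
  have [iv|] := eqVneq i v; last by rewrite mulg1.
  rewrite inH /=; last by rewrite /star /= iv eqxx.
  by case: ifP => _; rewrite ?mulg1 // -incM.
- move=> h i j a b eij; rewrite /wall_letter /at_v /=.
  have [iv|niv] := eqVneq i v; have [jv|njv] := eqVneq j v; rewrite /= ?mulg1 ?mul1g //.
  + by have := irrE v; rewrite -{1}iv -jv eij.
  + by rewrite inH // /star /= -iv eij orbT.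
  + by rewrite inH // /star /= -jv symE eij orbT.
Qed.

Lemma wall_crossing_cat g u w :
  wall_crossing g (u ++ w) = wall_crossing g u * wall_crossing (g * ev u) w.
Proof. exact: cochain_cat. Qed.

Lemma wall_crossing_starl h g w : star_group h -> wall_crossing (h * g) w = wall_crossing g w.
Proof.
move=> hh; rewrite /wall_crossing; elim: w g => //= l w IH g; rewrite -mulgA IH; congr (_ * _).
by rewrite /wall_letter (asbool_equiv_eq (star_groupMl g hh)).
Qed.

Lemma wall_crossing_neq1 g w : wall_crossing g w <> 1 ->
  exists w1 l w2, [/\ w = w1 ++ l :: w2, at_v l & star_group (g * ev w1)].
Proof.
rewrite /wall_crossing; elim: w g => [|l w IH] g //=.
rewrite {1}/wall_letter; case: ifP => [/andP[vl /asboolP hg] _|_].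
  by exists [::], l, w; rewrite ev_nil mulg1.
rewrite mul1g => /IH[w1 [l' [w2 [-> vl hg]]]].
by exists (l :: w1), l', w2; rewrite ev_cons mulgA.
Qed.

(** The base point moves the wall crossed by [l] to [star_group]; by [minimal_no_return], no letter
    before or after [l] crosses it. *)
Lemma minimal_crossing w1 l w2 : minimal (w1 ++ l :: w2) -> at_v l ->
  wall_crossing (ev w1)^-1 (w1 ++ l :: w2) = ev [:: l].
Proof.
move=> m vl; rewrite wall_crossing_cat mulVg.
have -> : wall_crossing (ev w1)^-1 w1 = 1.
  apply: contrapT => /wall_crossing_neq1[u1 [l' [u2 [Ew vl' hs]]]].
  rewrite Ew ev_cat invMg mulgKV in hs.
  apply: (@minimal_no_return l' u2 l) => //.
    by apply: (@minimal_sub u1 _ w2); rewrite /= -catA /= -cat_cons catA -Ew.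
  have := star_groupV hs; rewrite invgK ev_cons.
  by move=> /star_groupMl; apply; apply/star_group_letter/at_v_star.
rewrite mul1g /wall_crossing /= {1}/wall_letter vl asboolT; last exact: star_group1.
rewrite mul1g; suff -> : cochain wall_letter (ev [:: l]) w2 = 1 by rewrite mulg1.
apply: contrapT => /wall_crossing_neq1[u1 [l' [u2 [Ew vl' hs]]]].
apply: (@minimal_no_return l u1 l') => //.
  by apply: (@minimal_sub w1 _ u2); rewrite /= -catA /= -Ew.
by move: hs => /star_groupMl; apply; apply/star_group_letter/at_v_star.
Qed.

(** An entry [t] stands for the coset of [star_group] through [t], crossed there by a letter of
    [F v]. *)
Fixpoint walls g w : seq G :=
  if w is l :: w' then
    if at_v l then g :: walls (g * ev [:: l]) w' else walls (g * ev [:: l]) w'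
  else [::].

Lemma size_walls g w : size (walls g w) = count at_v w.
Proof. by elim: w g => //= l w IH g; case: ifP => _ /=; rewrite IH. Qed.

Lemma wallsP g w t : t \in walls g w ->
  exists w1 l w2, [/\ w = w1 ++ l :: w2, at_v l & t = g * ev w1].
Proof.
elim: w g => //= l w IH g; case: ifP => vl.
  rewrite inE => /orP[/eqP ->|]; first by exists [::], l, w; rewrite ev_nil mulg1.
  by move=> /IH[w1 [l' [w2 [-> vl' ->]]]]; exists (l :: w1), l', w2; rewrite [ev (l :: w1)]ev_cons mulgA.
by move=> /IH[w1 [l' [w2 [-> vl' ->]]]]; exists (l :: w1), l', w2; rewrite [ev (l :: w1)]ev_cons mulgA.
Qed.

Definition distinct_walls : rel G := fun t t' => ~~ `[< star_group (t^-1 * t') >].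

Lemma minimal_walls g w : minimal w -> pairwise distinct_walls (walls g w).
Proof.
elim: w g => // l w IH g m /=.
have mw : minimal w by apply: (@minimal_sub [:: l] w [::]); rewrite cats0.
case: ifP => vl /=; last exact: IH.
rewrite IH // andbT; apply/allP => t /wallsP[w1 [l' [w2 [Ew vl' ->]]]].
apply/asboolPn; rewrite -mulgA mulKg => /star_groupMl hs.
apply: (@minimal_no_return l w1 l') => //.
  by apply: (@minimal_sub [::] _ w2); rewrite /= -catA /= -Ew.
by apply: hs; apply/star_group_letter/at_v_star.
Qed.

(** A letter of [F v] crosses at most one of these distinct walls and other letters cross none;
    induct after discarding the wall crossed by the first letter. *)
Lemma crossed_walls_size (L : seq G) g w : pairwise distinct_walls L ->
  (forall t, t \in L -> wall_crossing (t^-1 * g) w <> 1) -> (size L <= count at_v w)%N.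
Proof.
elim: w L g => [|l w IH] L g pw hL.
  by case: L hL {pw} => // t L /(_ t); rewrite inE eqxx => /(_ isT).
rewrite /=; case vl : (at_v l); last first.
  apply: (IH L (g * ev [:: l])) => // t /hL.
  by rewrite /wall_crossing /= {1}/wall_letter vl mul1g mulgA.
pose p t := `[< star_group (t^-1 * g) >].
rewrite -(count_predC p L) leq_add //.
  apply: pairwise_count1 pw _ => x y /asboolP hx /asboolP hy.
  rewrite /distinct_walls negbK; apply/asboolP.
  have := star_groupM hx (star_groupV hy).
  by rewrite invMg invgK mulgA mulgK.
rewrite -size_filter; apply: (IH _ (g * ev [:: l])).
  by apply: subseq_pairwise pw; apply: filter_subseq.
move=> t; rewrite mem_filter => /andP[/= npt /hL].
by rewrite /wall_crossing /= {1}/wall_letter -/(p t) (negbTE npt) andbF mul1g mulgA.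
Qed.

(** The letters of [F v] in [w] cross distinct walls with nontrivial values. These values depend
    only on the end points, so [w'] crosses all of these walls too. *)
Lemma minimal_count w w' : minimal w -> ev w = ev w' -> (count at_v w <= count at_v w')%N.
Proof.
move=> m E; rewrite -(size_walls 1); apply: (@crossed_walls_size _ 1).
  exact: minimal_walls.
move=> t /wallsP[w1 [l [w2 [Ew vl ->]]]].
rewrite mul1g mulg1 -(wall_crossing_ev _ E) Ew minimal_crossing -?Ew //.
apply: minimal_letter; apply: (@minimal_sub w1 _ w2).
by rewrite /= -Ew.
Qed.

End Walls.

(** * Walls far from both ends of a word, and their sides *)

Section DeepWalls.
Variables (I : finType) (e : rel I) (F : I -> finGroupType).
Hypothesis He : simplicial_graph e.

Local Notation G := (graph_product e F).
Local Notation letter := {i : I & F i}.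
Local Notation ev := (@ev I e F).
Local Notation inc := (@inc I e F).
Local Notation star_group := (@star_group I e F).
Local Notation wall_crossing := (@wall_crossing I e F).
Local Notation minimal := (@minimal I e F).
Implicit Types (g h t x y z : G) (u w k : seq letter) (l : letter) (i j v : I).

Lemma size_sum_count w : size w = (\sum_v count (at_v v) w)%N.
Proof.
elim: w => [|l w IH] /=; first by rewrite big1.
rewrite big_split /= -IH (bigD1 (tag l)) //= big1 /at_v ?eqxx //.
by move=> i /negbTE ni; rewrite eq_sym ni.
Qed.

Lemma count_link v k : all (link e v) k -> count (at_v v) k = 0%N.
Proof.
elim: k => //= l k IH /andP[el /IH ->]; rewrite addn0.
by rewrite /at_v; have [E|//] := eqVneq (tag l) v; move: el; rewrite /link E He.2.
Qed.

Lemma word_inv_link v k : all (link e v) k -> all (link e v) (word_inv k).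
Proof. by rewrite /word_inv all_rev all_map; apply: sub_all => -[]. Qed.

Lemma incV v (a : F v) : inc a^-1 = (inc a)^-1.
Proof. by rewrite /inc -ev_inv. Qed.

(** A word between an end of [w] and a point of the wall, completed by a link word and one letter of
    [F v], has the value of the part of [w] on that side; [minimal_count] compares their letters of
    [F v]. *)
Lemma deep_wall n : exists D, forall w, minimal w -> (D < size w)%N -> exists v t,
  wall_crossing v t^-1 w <> 1 /\ forall h w', star_group v h ->
    (ev w' = t * h -> (n <= size w')%N) /\ (ev w' = (t * h)^-1 * ev w -> (n <= size w')%N).
Proof.
exists (#|I| * (2 * n + 2))%N => w mw sw.
have [v cv] : exists v, (2 * n + 2 < count (at_v v) w)%N.
  apply: contrapT => nv; move: sw; rewrite ltnNge => /negP; apply.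
  rewrite size_sum_count -sum_nat_const; apply: leq_sum => i _.
  by rewrite leqNgt; apply/negP => ci; apply: nv; exists i.
(* At least [n + 1] letters of [F v] remain on each side of [l]: [n] for the bound and one for the
   component of [h] in [F v]. *)
have [|w1 [l [w2 [Ew vl c1]]]] := @count_split _ (at_v v) n.+1 w; first by lia.
have c2 : (n < count (at_v v) w2)%N.
  by move: cv; rewrite Ew count_cat /= vl c1; lia.
rewrite Ew in mw *; exists v, (ev w1); split.
  rewrite minimal_crossing //; apply: minimal_letter.
  exact: (@minimal_sub _ _ _ w1 _ w2).
move=> h w' [w0 aw0 Eh].
have [a [k [lk Ek _]]] : exists (a : F v) u, [/\ all (link e v) u, ev w0 = inc a * ev u
    & (size u <= size w0)%N] by apply: star_word.
rewrite {}Ek in Eh; split=> E.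
  have m1 : minimal w1 by apply: (@minimal_sub _ _ _ [::] _ (l :: w2)).
  have : ev w1 = ev (w' ++ word_inv k ++ [:: lett a^-1]).
    by rewrite !ev_cat E ev_inv -/(inc _) incV -Eh -invMg mulgK.
  move/(@minimal_count _ _ _ He v _ _ m1).
  rewrite c1 !count_cat (count_link (word_inv_link lk)) /=.
  by have := count_size (at_v v) w'; case: at_v => /=; lia.
have m2 : minimal w2 by apply: (@minimal_sub _ _ _ (w1 ++ [:: l]) _ [::]); rewrite cats0 -catA.
have [b Eb] := at_vP vl.
have : ev w2 = ev (lett (b^-1 * a) :: k ++ w').
  rewrite ev_cons ev_cat E -/(inc _) incM incV -Eh ev_cat ev_cons Eb -/(inc b).
  by rewrite !invMg !mulgA mulgK mulgK mulgKV mulVg mul1g.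
move/(@minimal_count _ _ _ He v _ _ m2).
rewrite /= count_cat (count_link lk).
by have := count_size (at_v v) w'; case: at_v => /=; lia.
Qed.

Lemma trivial_crossing v g w : (forall a : F v, inc a = 1) -> wall_crossing v g w = 1.
Proof.
move=> triv; rewrite /wall_crossing; elim: w g => //= l w IH g; rewrite IH mulg1 /wall_letter.
by case: ifP => // /andP[/at_vP[a ->]] _; apply: triv.
Qed.

(** Suppose [z] is outside the star group and compare the crossings of the equal products of [z^-1]
    and [a] in both orders. The letter [a] contributes only when it is read first, which forces
    [inc a = 1]. *)
Lemma centralizer_star v z : (exists a : F v, inc a <> 1) ->
  (forall a : F v, z * inc a = inc a * z) -> star_group v z.
Proof.
move=> [a na] za; apply: contrapT => nz.
have az : z^-1 * inc a = inc a * z^-1.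
  by apply: (mulgI z); rewrite mulKVg mulgA za mulgK.
have sa : star_group v (inc a) by apply: star_group_letter; rewrite /star /= eqxx.
apply: na; apply: (mulIg (wall_crossing v 1 (word_of z^-1))); rewrite mul1g.
have : ev (word_of z^-1 ++ [:: lett a]) = ev (lett a :: word_of z^-1).
  by rewrite ev_cat [RHS]ev_cons word_ofK; exact: az.
move/(wall_crossing_ev He v 1); rewrite wall_crossing_cat word_ofK mul1g.
rewrite {2 3}/wall_crossing /= /wall_letter /at_v eqxx /= asboolF; last first.
  by move=> hz; apply: nz; rewrite -(invgK z); apply: star_groupV.
rewrite !mulg1 asboolT; last exact: star_group1.
rewrite mul1g => E; rewrite [RHS]E; congr (_ * _).
by rewrite -[LHS](wall_crossing_starl _ _ sa) mulg1.
Qed.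

(** These are the unions of sides of the wall [t * star_group], so that a side and its complement
    are treated alike. *)
Definition saturated v t (A : set G) : Prop :=
  forall x w, A x -> wall_crossing v (t^-1 * x) w = 1 -> A (x * ev w).

Lemma saturatedC v t A : saturated v t A -> saturated v t (~` A).
Proof.
move=> sA x w nAx c1 Ay; apply: nAx.
rewrite -(mulgK (ev w) x) -ev_inv; apply: sA => //.
have : ev (w ++ word_inv w) = ev [::] by rewrite ev_cat ev_inv mulgV.
by move/(wall_crossing_ev He v (t^-1 * x)); rewrite wall_crossing_cat c1 mul1g mulgA.
Qed.

Lemma saturated_exit v t A x y w : saturated v t A -> A x -> ~ A y -> ev w = x^-1 * y ->
  exists h w1 w2, [/\ star_group v h, w = w1 ++ w2, t * h = x * ev w1 & ev w2 = (t * h)^-1 * y].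
Proof.
move=> sA Ax nAy Ew.
have /wall_crossing_neq1[w1 [l [w2 [E vl hs]]]] : wall_crossing v (t^-1 * x) w <> 1.
  by move=> /(sA _ _ Ax); rewrite Ew mulKVg.
exists (t^-1 * x * ev w1), w1, (l :: w2); split=> //.
  by rewrite -!mulgA mulKVg.
rewrite -!mulgA mulKVg invMg -mulgA; apply: (mulgI (ev w1)).
by rewrite -ev_cat -E Ew mulKVg.
Qed.

Lemma saturated_side v t q : saturated v t [set x | wall_crossing v (t^-1 * q) (word_of (q^-1 * x)) = 1].
Proof.
move=> x w /= cx cw.
have : ev (word_of (q^-1 * (x * ev w))) = ev (word_of (q^-1 * x) ++ w).
  by rewrite ev_cat !word_ofK mulgA.
move/(wall_crossing_ev He v (t^-1 * q)) ->.
by rewrite wall_crossing_cat cx mul1g word_ofK -mulgA mulKVg.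
Qed.

End DeepWalls.

(** * Quasiconvexity of the sides of a wall *)

Lemma finite_ffun (K : finType) (U : choiceType) (B : set U) : finite_set B ->
  finite_set [set g : {ffun K -> U} | forall k, B (g k)].
Proof.
move=> /finite_seqP[s Es].
have [u0|nou] := pselect (exists u : U, True); last first.
  apply: (@sub_finite_set _ _ (range (fun g : {ffun K -> void} => [ffun k => of_void U (g k)]))).
    move=> g _; have noK (k : K) : void by case: nou; exists (g k).
    by exists [ffun k => noK k] => //; apply/ffunP => k; case: (noK k).
  exact/finite_image/finite_finset.
have [u _] := u0.
apply: (@sub_finite_set _ _
  (range (fun g : {ffun K -> 'I_(size s)} => [ffun k => nth u s (g k)]))).
  move=> g /= Bg; have ks k : g k \in s by have := Bg k; rewrite Es.
  have lt k : (index (g k) s < size s)%N by rewrite index_mem.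
  by exists [ffun k => Ordinal (lt k)] => //; apply/ffunP => k; rewrite !ffunE /= nth_index.
exact/finite_image/finite_finset.
Qed.

(** Finitely many functions with values in [B] occur as [f x]; choose one preimage [y] of each and
    bound [d] on these choices. The value [0] in the proof stands in for functions without a
    preimage. *)
Lemma finite_type_bound (T : choiceType) (K : finType) (U : choiceType) (f : T -> K -> U)
    (B : set U) (d : T -> nat) : finite_set B ->
  exists n, forall x, (forall k, B (f x k)) ->
    exists y, (forall k, f y k = f x k) /\ (d y <= n)%N.
Proof.
move=> fB; have fP := @finite_ffun K _ _ fB.
have [n hn] := finite_set_bound (fun g : {ffun K -> U} =>
  if pselect (exists y, forall k, f y k = g k) is left h then d (projT1 (cid h)) else 0%N) fP.
exists n => x Bx; have := hn [ffun k => f x k].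
case: pselect => [h|[]]; last by exists x => k; rewrite ffunE.
case: (cid h) => y /= hy le_n; exists y; split; first by move=> k; rewrite hy ffunE.
by apply: le_n => k; rewrite ffunE.
Qed.

Section Orbit.
Variables (I : finType) (e : rel I) (F : I -> finGroupType).
Hypothesis He : simplicial_graph e.

Local Notation G := (graph_product e F).
Local Notation ev := (@ev I e F).
Local Notation inc := (@inc I e F).
Local Notation star_group := (@star_group I e F).

Variables (X : cube_complex) (a : cubical_action G X) (x0 : X).
Hypotheses (catX : CAT0 X) (pr : proper_action a) (cc : cocompact_action a).
Hypothesis sc : strongly_cellular a.
Implicit Types (g h q : G) (v : I) (w : seq {i : I & F i}) (x y z m : X).

Lemma orbit_lipschitz : exists n, forall w, (dist x0 (a (ev w) x0) <= n * size w)%N.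
Proof.
exists (\max_(l : {i : I & F i}) dist x0 (a (ev [:: l]) x0))%N.
elim=> [|l w IH]; first by rewrite ev_nil Defs.act1 distxx.
rewrite ev_cons Defs.actM; apply: leq_trans (dist_triangle catX (a (ev [:: l]) x0) _ _) _.
rewrite act_dist // mulnS leq_add //.
exact: (@leq_bigmax _ (fun l : {i : I & F i} => dist x0 (a (ev [:: l]) x0))).
Qed.

Lemma finite_displacement n : finite_set [set g | (dist x0 (a g x0) <= n)%N].
Proof.
apply: sub_finite_set (pr (finite_ball catX pr cc x0 n)) => g hg.
by exists x0 => //=; rewrite distxx.
Qed.

Lemma orbit_proper n : exists N, forall g h, (dist (a g x0) (a h x0) <= n)%N ->
  exists2 w, ev w = g^-1 * h & (size w <= N)%N.
Proof.
have [N hN] := finite_set_bound (fun g => size (word_of g)) (finite_displacement n).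
exists N => g h le_n; exists (word_of (g^-1 * h)); first exact: word_ofK.
by apply: hN; rewrite /= Defs.actM -act_distV.
Qed.

Section Vertex.
Variable v : I.
Hypothesis ntv : exists b : F v, inc b <> 1.

Let fixv : set X := fixed_by a (fun b : F v => inc b).

(** The star group preserves the fixed point set, because link letters commute with [F v]; so a
    fixed point can be carried along with [x0]. *)
Lemma star_orbit_near_fixed : exists n, forall h, star_group v h ->
  exists2 y, fixv y & (dist (a h x0) y <= n)%N.
Proof.
have [y0 fy0] : fixv !=set0 by apply: (fixed_by_nonempty catX sc (@incM _ _ _ v)).
exists (dist x0 y0) => h [w aw <-]; exists (a (ev w) y0); last by rewrite act_dist.
have [b [k [lk -> _]]] := star_word aw.
move=> c; rewrite -Defs.actM mulgA -incM -!(inc_link _ lk) !Defs.actM.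
by rewrite !fy0.
Qed.

(** If [g x0] is near [y], the conjugates of [F v] by [g] move [x0] boundedly, so they follow
    finitely many patterns. Dividing [g] by a bounded [g'] with the same pattern gives a centralizer
    of [F v], hence an element of the star group. *)
Lemma fixed_near_star_orbit : exists n, forall y, fixv y ->
  exists2 h, star_group v h & (dist y (a h x0) <= n)%N.
Proof.
have [R hR] := cobounded catX cc x0.
have [n hn] := @finite_type_bound G (F v) G (fun g b => g^-1 * inc b * g) _
  (fun g => dist (a g x0) x0) (finite_displacement (R + R)).
exists (R + n)%N => y fy; have [g hg] := hR y.
have [b|g' [Eg' le_n]] := hn g.
  rewrite /= !Defs.actM -act_distV //.
  apply: leq_trans (dist_triangle catX y _ _) _.
  apply: leq_add; first by rewrite dist_sym.
  by rewrite -{1}(fy b) act_dist.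
exists (g * g'^-1).
  apply: (centralizer_star He ntv) => b; have := Eg' b.
  move/(congr1 (fun z : G => g * z * g'^-1)).
  by rewrite !mulgA mulgK mulgV mul1g => ->.
apply: leq_trans (dist_triangle catX (a g x0) _ _) _.
by rewrite leq_add // Defs.actM act_dist // -act_distV //.
Qed.

(** The point [x] is near the orbit only through some [g'] outside [A]. As [g] and [g'] are joined
    by a short word, that word meets the wall near [g]. *)
Lemma saturated_boundary n : exists R : nat, forall t A x g z,
  saturated v t A -> A g -> (dist z (a g x0) <= n)%N -> adjacent z x ->
  (forall g', A g' -> (n < dist x (a g' x0))%N) ->
  (exists g', (dist x (a g' x0) <= n)%N) ->
  exists2 h, star_group v h & (dist z (a (t * h)%g x0) <= R)%N.
Proof.
have [L hL] := orbit_proper (n + n).+1; have [c hc] := orbit_lipschitz.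
exists (n + c * L)%N => t A x g z sA Ag zg zx far [g' xg'].
have [w Ew sw] : exists2 w, ev w = g^-1 * g' & (size w <= L)%N.
  apply: hL; apply: leq_trans (dist_triangle catX z _ _) _.
  rewrite dist_sym // -addnS leq_add //.
  apply: leq_trans (dist_triangle catX x _ _) _.
  by rewrite (dist1 catX zx) add1n ltnS.
have nAg' : ~ A g' by move=> /far; rewrite ltnNge xg'.
have [h [w1 [w2 [hh E Eth _]]]] := saturated_exit sA Ag nAg' Ew.
exists h => //; rewrite Eth Defs.actM.
apply: leq_trans (dist_triangle catX (a g x0) _ _) _.
rewrite leq_add // act_dist //; apply: leq_trans (hc w1) _.
by rewrite leq_mul2l (leq_trans _ sw) ?orbT // E size_cat leq_addr.
Qed.

Lemma leave_set (P : set X) x m : P x -> ~ P m ->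
  exists z z', [/\ P z, ~ P z', adjacent z z' & (dist x z + dist z m)%N = dist x m].
Proof.
have [n] := ubnP (dist x m); elim: n x => // n IH x le_n Px nPm.
have [x0'|xm0] := posnP (dist x m); first by case: nPm; rewrite -(dist_eq0 catX x0').
have [y xy ey] := geodesic_step catX xm0.
have [Py|nPy] := pselect (P y); last first.
  by exists x, y; rewrite distxx.
have [|//|//|z [z' [Pz nPz' zz' Ez]]] := IH y; first by lia.
exists z, z'; split=> //; have := dist_triangle catX y x z; have := dist_triangle catX z x m.
by rewrite (dist1 catX xy); lia.
Qed.

(** If [m] is near the orbit of [A], a short word from [A] to [q] meets the wall. Otherwise the
    geodesic leaves the neighbourhood [P] of that orbit on both sides of [m], near the translate by
    [t] of the convex fixed set, which is therefore near [m]. *)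
Lemma saturated_quasiconvex n : exists R : nat, forall t A g1 g2 q m,
  saturated v t A -> A g1 -> A g2 -> ~ A q ->
  (dist (a g1 x0) m + dist m (a g2 x0))%N = dist (a g1 x0) (a g2 x0) ->
  (dist (a q x0) m <= n)%N ->
  exists h w, [/\ star_group v h, ev w = (t * h)^-1 * q & (size w <= R)%N].
Proof.
have [R0 hR0] := cobounded catX cc x0.
have [R1 hR1] := saturated_boundary R0.
have [R2 hR2] := star_orbit_near_fixed.
have [R3 hR3] := fixed_near_star_orbit.
have [L1 hL1] := orbit_proper (R0 + n).
(* The exits are within [R1 + R2] of the fixed set, [convex_coarse] doubles this for [m], and [R3]
   and [n] lead on to the wall and to [q]. *)
have [L2 hL2] := orbit_proper ((R1 + R2).*2 + R3 + n).
exists (maxn L1 L2) => t A g1 g2 q m sA A1 A2 nAq Em qm.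
pose P z := exists2 g, A g & (dist z (a g x0) <= R0)%N.
have P1 : P (a g1 x0) by exists g1; rewrite ?distxx.
have P2 : P (a g2 x0) by exists g2; rewrite ?distxx.
have [[g Ag mg]|nPm] := pselect (P m).
  have [|w Ew sw] := hL1 g q.
    apply: leq_trans (dist_triangle catX m _ _) _.
    by rewrite leq_add // dist_sym.
  have [h [w1 [w2 [hh E _ Ew2]]]] := saturated_exit sA Ag nAq Ew.
  exists h, w2; split=> //; rewrite leq_max (leq_trans _ sw) // E size_cat.
  exact: leq_addl.
have near z z' : P z -> ~ P z' -> adjacent z z' ->
    exists2 y, fixv y & (dist (a t^-1 z) y <= R1 + R2)%N.
  move=> [g Ag zg] nPz' zz'.
  have [||h hh zh] := hR1 t A z' g z sA Ag zg zz'.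
  - by move=> g' Ag'; rewrite ltnNge; apply/negP => le; apply: nPz'; exists g'.
  - exact: hR0.
  have [y fy hy] := hR2 h hh; exists y => //.
  apply: leq_trans (dist_triangle catX (a h x0) _ _) _; rewrite leq_add //.
  by rewrite act_distV // invgK -Defs.actM.
have [z1 [z1' [Pz1 nPz1' zz1 E1]]] := leave_set P1 nPm.
have [z2 [z2' [Pz2 nPz2' zz2 E2]]] := leave_set P2 nPm.
have cF : convex fixv := fixed_by_convex catX sc (@incM _ _ _ v).
have [|y fy my] := convex_coarse catX cF (near _ _ Pz1 nPz1' zz1) (near _ _ Pz2 nPz2' zz2)
  (p := a t^-1 m).
  rewrite !act_dist //.
  have := dist_triangle catX z1 (a g1 x0) (a g2 x0).
  have := dist_triangle catX z2 z1 (a g2 x0); have := dist_triangle catX m z1 z2.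
  rewrite (dist_sym catX z2 (a g2 x0)) (dist_sym catX m z2).
  by rewrite (dist_sym catX m (a g2 x0)) in Em; lia.
have [h hh yh] := hR3 y fy.
have [|w Ew sw] := hL2 (t * h) q.
  rewrite dist_sym //; apply: leq_trans (dist_triangle catX m _ _) _.
  rewrite addnC leq_add //.
  rewrite Defs.actM -(invgK t) -act_distV //.
  by apply: leq_trans (dist_triangle catX y _ _) _; rewrite leq_add.
by exists h, w; split=> //; rewrite leq_max sw orbT.
Qed.

End Vertex.

Lemma uniform_quasiconvex n : exists R : nat, forall v t A g1 g2 q m,
  (exists b : F v, inc b <> 1) ->
  saturated v t A -> A g1 -> A g2 -> ~ A q ->
  on_geodesic (a g1 x0) (a g2 x0) m -> (dist (a q x0) m <= n)%N ->
  exists h w, [/\ star_group v h, ev w = (t * h)^-1 * q & (size w <= R)%N].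
Proof.
have /choice[R hR] : forall v, exists R : nat, (exists b : F v, inc b <> 1) ->
    forall t A g1 g2 q m, saturated v t A -> A g1 -> A g2 -> ~ A q ->
    on_geodesic (a g1 x0) (a g2 x0) m -> (dist (a q x0) m <= n)%N ->
    exists h w, [/\ star_group v h, ev w = (t * h)^-1 * q & (size w <= R)%N].
  move=> v; have [ntv|nt] := pselect (exists b : F v, inc b <> 1); last by exists 0%N.
  have [R hR] := saturated_quasiconvex ntv n; exists R => _ t A g1 g2 q m sA A1 A2 nAq.
  by move=> /(on_geodesicP catX) hm; apply: (hR t A g1 g2 q m sA A1 A2 nAq hm).
exists (\max_v R v)%N => v t A g1 g2 q m nt sA A1 A2 nAq hm hq.
have [h [w [hh Ew sw]]] := hR v nt t A g1 g2 q m sA A1 A2 nAq hm hq.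
by exists h, w; split=> //; apply: leq_trans sw (leq_bigmax _).
Qed.

End Orbit.

(** * Comparison with word metrics *)

Section WordLength.
Variables (I : finType) (e : rel I) (F : I -> finGroupType).
Hypothesis He : simplicial_graph e.

Local Notation G := (graph_product e F).
Local Notation ev := (@ev I e F).
Local Notation inc := (@inc I e F).

Lemma spells_cat (S : set G) s1 s2 (g1 g2 : G) :
  spells S s1 g1 -> spells S s2 g2 -> spells S (s1 ++ s2) (g1 * g2).
Proof.
move=> [h1 <-] [h2 <-]; split; last by rewrite big_cat.
by move=> h; rewrite mem_cat => /orP[/h1|/h2].
Qed.

Lemma word_length_bound (S : set G) : generates S ->
  exists n, forall w, (word_length S (ev w) <= n * size w)%N.
Proof.
move=> /choice[sp hsp].
exists (\max_(l : {i : I & F i}) size (sp (ev [:: l])))%N => w.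
have [s hs le_s] : exists2 s, spells S s (ev w) &
    (size s <= (\max_(l : {i : I & F i}) size (sp (ev [:: l]))) * size w)%N.
  elim: w => [|l w [s hs le_s]]; first by exists [::] => //; split=> //; rewrite big_nil.
  exists (sp (ev [:: l]) ++ s); first by rewrite [ev (l :: w)]ev_cons; apply: spells_cat.
  rewrite size_cat /= mulnS leq_add //.
  exact: (@leq_bigmax _ (fun l : {i : I & F i} => size (sp (ev [:: l])))).
apply: leq_trans le_s.
by have [] := @leastP [set n | exists2 s, spells S s (ev w) & size s = n] (size s);
  first by exists s.
Qed.

Lemma same_side (A : set G) g1 g2 g3 :
  (A g1 /\ A g2 \/ A g2 /\ A g3 \/ A g1 /\ A g3) \/
  (~ A g1 /\ ~ A g2 \/ ~ A g2 /\ ~ A g3 \/ ~ A g1 /\ ~ A g3).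
Proof.
by have [] := pselect (A g1); have [] := pselect (A g2); have [] := pselect (A g3); tauto.
Qed.

End WordLength.

Theorem theorem3p5 (I : finType) (e : rel I) (He : simplicial_graph e)
    (F : I -> finGroupType) (X Y : cube_complex)
    (aX : cubical_action (graph_product e F) X)
    (aY : cubical_action (graph_product e F) Y) :
  cocompact_cubulation aX -> strongly_cellular aX ->
  cocompact_cubulation aY -> strongly_cellular aY ->
  same_coarse_median_structure aX aY.
Proof.
move=> [catX prX ccX] scX [catY prY ccY] scY x0 y0 muX muY [NX hX] [NY hY] S _ genS.
have [RX qcX] := uniform_quasiconvex He x0 catX prX ccX scX NX.
have [RY qcY] := uniform_quasiconvex He y0 catY prY ccY scY NY.
(* The successor makes the wall strictly farther than both quasiconvexity constants. *)
have [D deep] := deep_wall F He (maxn RX RY).+1.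
have [L hL] := word_length_bound genS.
exists (L * D)%N => g1 g2 g3; set q := muX _ _ _; set q' := muY _ _ _.
have [w Ew minw] := minimal_ex (q^-1 * q').
have [small|big] := leqP (size w) D.
  by rewrite /word_metric -Ew (leq_trans (hL w)) // leq_mul2l small orbT.
have [v [t [cross far]]] := deep w minw big.
have nt : exists b : F v, inc e b <> 1.
  apply: contrapT => triv; apply: cross; apply: trivial_crossing => b.
  by apply: contrapT => nb; apply: triv; exists b.
(* The wall found for [q^-1 * q'] is translated by [q], and [A] is the side of [q]; the nontrivial
   crossing puts [q'] outside. *)
pose A := [set x | wall_crossing v ((q * t)^-1 * q) (word_of (q^-1 * x)) = 1].
have sA : saturated v (q * t) A by apply: saturated_side.
have Aq : A q.
  by rewrite /A /= mulVg; apply: (wall_crossing_ev He v _ (w := [::])); rewrite word_ofK.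
have nAq' : ~ A q'.
  rewrite /A /= invMg mulgKV => h; apply: cross; rewrite -h.
  by apply: wall_crossing_ev; rewrite // word_ofK.
have [mX [x12 x23 x13]] := is_median_ex catX (aX g1 x0) (aX g2 x0) (aX g3 x0).
have [mY [y12 y23 y13]] := is_median_ex catY (aY g1 y0) (aY g2 y0) (aY g3 y0).
have qX : (dist (aX q x0) mX <= NX)%N by apply: hX.
have qY : (dist (aY q' y0) mY <= NY)%N by apply: hY.
(* Two points in [A] have the median in [Y] near [q'] between them, which brings [q'] too close to
   the wall; two points outside do the same to [q] in [X]. *)
exfalso; case: (same_side A g1 g2 g3) => side.
  have [h [u [hh Eu su]]] : exists h u, [/\ star_group v h, ev e u = (q * t * h)^-1 * q'
      & (size u <= RY)%N].
    case: side => [[A1 A2]|[[A1 A2]|[A1 A2]]].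
    - exact: qcY v _ _ _ _ _ _ nt sA A1 A2 nAq' y12 qY.
    - exact: qcY v _ _ _ _ _ _ nt sA A1 A2 nAq' y23 qY.
    - exact: qcY v _ _ _ _ _ _ nt sA A1 A2 nAq' y13 qY.
  have [_] := far h u hh; rewrite Eu Ew -mulgA invMg mulgA => /(_ erefl).
  by rewrite ltnNge leq_max su orbT.
have sAC := saturatedC He sA; have nAq : ~ (~` A) q by apply.
have [h [u [hh Eu su]]] : exists h u, [/\ star_group v h, ev e u = (q * t * h)^-1 * q
    & (size u <= RX)%N].
  case: side => [[A1 A2]|[[A1 A2]|[A1 A2]]].
  - exact: qcX v _ _ _ _ _ _ nt sAC A1 A2 nAq x12 qX.
  - exact: qcX v _ _ _ _ _ _ nt sAC A1 A2 nAq x23 qX.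
  - exact: qcX v _ _ _ _ _ _ nt sAC A1 A2 nAq x13 qX.
have [+ _] := far h (word_inv u) hh.
rewrite ev_inv Eu -mulgA invMg invgK mulKg => /(_ erefl).
by rewrite /word_inv size_rev size_map ltnNge leq_max su.
Qed.
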